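(* Let $u_1\in BUSC(\overline\Omega)$ and $u_2\in BLSC(\overline\Omega)$ be, respectively, a viscosity subsolution and a viscosity supersolution (in the sense given in the context) of $$\min\big(\partial_s u+\partial_p u+H(s,x,q,\nabla_x u),\ u-\varphi(x)\big)=0,\qquad (x,q,p,s)\in\Omega,$$ $$u(x,q,0,s)-(Mu)(x,q,0,s)=0,\qquad (x,q,s)\in X\times Q\times[0,t],$$ $$u(x,q,p,0)=\max(\phi(x),\varphi(x)),\qquad (x,q,p)\in X\times Q\times P.$$ Then $u_1\le u_2$ in $\overline\Omega$.
   Context: **Setting.** $X=\mathbb R^d$; $Q=\{0,1,\dots,d_q\}$ is finite (discrete topology); $\delta>0$; $t>0$ is fixed; $P=(0,t]$, $T=(0,t]$, $\Omega=X\times Q\times P\times T$ with closure $\overline\Omega=X\times Q\times[0,t]\times[0,t]$. For each $q\in Q$, $U(q)\subset\mathbb R^m$ is the set of continuous control values and $W(q)\subset Q$ the set of discrete decisions; $f(s,y,u,q)\in X$ is defined for $s\ge0$, $y\in X$, $u\in U(q)$, and $g(w,q)\in Q$ for $w\in W(q)$. $BUSC$ and $BLSC$ denote bounded upper, respectively lower, semicontinuous functions. **Standing assumptions.** (H1) There is $L_f>0$ such that for all $s\ge0$, $y,y'\in X$, $q\in Q$, $u\in U(q)$: $\|f(s,y,u,q)-f(s,y',u,q)\|\le L_f\|y-y'\|$ and $\|f(s,y,u,q)\|\le L_f$. (H2) For all $q\in Q$, $f(\cdot,\cdot,\cdot,q)$ is continuous, and for all $s,x,u$, $f(s,x,u,\cdot)$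 is continuous on $Q$ for the discrete topology. (H3) For all $s\in[0,t]$, $y\in X$, $q\in Q$, the set $f(s,y,U(q),q)$ is convex. (H4) There is $L_g>0$ with $\|g(w,q)\|\le L_g$ for all $q\in Q$, $w\in W(q)$. (H5) $g$ is continuous for the discrete topology. **Functions.** Let $K\subset X$ be compact and $X_0\subset X$. $\tilde\phi,\tilde\varphi:X\to\mathbb R$ are Lipschitz continuous with $\tilde\phi(x)\le0\Leftrightarrow x\in X_0$ and $\tilde\varphi(x)\le0\Leftrightarrow x\in K$; for a constant $L_K>0$, $\phi=\max(\min(\tilde\phi,L_K),-L_K)$, $\varphi=\max(\min(\tilde\varphi,L_K),-L_K)$. **Hamiltonian.** $H(s,x,q,z)=\sup_{u\in U(q)}f(s,x,u,q)\cdot z$. **Envelopes and switch operators.** For bounded $u:\overline\Omega\to\mathbb R$, $u^*$ and $u_*$ are its upper and lower semicontinuous envelopes. At points with $p=0$, $$(Mu)(x,q,0,s)=\inf_{w\in W(q),\,p'\ge\delta}u(x,g(w,q),p',s),$$ and $M^+u$, $M^-u$ are given by the same formula with $u$ replaced on the right by $u^*$, respectively $u_*$. **Viscosity sub/supersolutions.** An upper semicontinuous $u_1$ on $\overline\Omega$ is a subsolution if for every continuously differentiable $\psi$ and every local maximum point $(x,q,p,s)\in\overline\Omega$ of $u_1-\psi$: if $(x,q,p,s)\in\Omega$ then $\min(\partial_s\psi+\partial_p\psi+H(s,x,q,\nabla_x\psi),\,u_1-\varphi(x))\le0$; if $p=0$ then $u_1(x,q,p,s)\le(M^+u_1)(x,q,p,s)$;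 if $s=0$ then $u_1(x,q,p,s)\le\max(\phi(x),\varphi(x))$. A lower semicontinuous $u_2$ is a supersolution if the same holds with local minima of $u_2-\psi$, all inequalities reversed, and $M^-$ in place of $M^+$. *)

(* Defs.v *)
From HB Require Import structures.
From mathcomp Require Import all_boot all_order all_algebra.
From mathcomp Require Import all_classical all_reals all_analysis.

Set Implicit Arguments.
Unset Strict Implicit.
Unset Printing Implicit Defensive.

Import Order.TTheory GRing.Theory Num.Theory.
Import numFieldNormedType.Exports.

Local Open Scope classical_set_scope.
Local Open Scope ring_scope.

(* The norm of the library on ['rV[R]_d] is the sup norm; [enorm] is the
   Euclidean one. *)
Definition dotp (R : realType) (d : nat) (y z : 'rV[R]_d) : R :=
  \sum_(i < d) y 0 i * z 0 i.

Definition enorm (R : realType) (d : nat) (y : 'rV[R]_d) : R :=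
  Num.sqrt (dotp y y).

(* [Q = {0, 1, ..., dq}]; elements coerce to [nat] through [nat_of_ord]. *)
Notation mode dq := (discrete_topology 'I_dq.+1).

Notation state R d dq := ('rV[R]_d * mode dq * R * R)%type.

Section Problem.
Context (R : realType) (d m dq : nat).

Local Notation X := 'rV[R]_d.
Local Notation Q := (mode dq).

Variables (delta t : R).
Variables (U : Q -> set 'rV[R]_m) (W : Q -> set Q).
Variables (f : R -> X -> 'rV[R]_m -> Q -> X) (g : Q -> Q -> Q).

Definition Omega : set (state R d dq) :=
  [set z | 0 < z.1.2 <= t /\ 0 < z.2 <= t].

Definition Obar : set (state R d dq) :=
  [set z | 0 <= z.1.2 <= t /\ 0 <= z.2 <= t].

(* Functions on [Obar] are total functions of which only the values on [Obar]
   matter. *)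
Definition bounded_Obar (u : state R d dq -> R) : Prop :=
  exists C : R, forall z, Obar z -> `|u z| <= C.

Definition lsc_Obar (u : state R d dq -> R) : Prop :=
  lower_semicontinuous (fun z : subspace Obar => (u z)%:E).

Definition usc_Obar (u : state R d dq -> R) : Prop :=
  lsc_Obar (fun z => - u z).

Definition BUSC (u : state R d dq -> R) : Prop := bounded_Obar u /\ usc_Obar u.

Definition BLSC (u : state R d dq -> R) : Prop := bounded_Obar u /\ lsc_Obar u.

(* [within Obar (nbhs z)] is not punctured at [z]. *)
Definition usc_env (u : state R d dq -> R) (z : state R d dq) : \bar R :=
  limf_esup (fun z' => (u z')%:E) (within Obar (nbhs z)).

Definition lsc_env (u : state R d dq -> R) (z : state R d dq) : \bar R :=
  limf_einf (fun z' => (u z')%:E) (within Obar (nbhs z)).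

(* Suprema and infima are taken in [\bar R], so that they have their usual
   values [-oo] and [+oo] on the empty set. *)
Definition Ham (s : R) (x : X) (q : Q) (z : X) : \bar R :=
  ereal_sup [set (dotp (f s x v q) z)%:E | v in U q].

Definition Mop (v : state R d dq -> \bar R) (x : X) (q : Q) (s : R) : \bar R :=
  ereal_inf [set v (x, g wp.1 q, wp.2, s) |
             wp in [set wp : Q * R | W q wp.1 /\ delta <= wp.2 <= t]].

Definition Mplus (u : state R d dq -> R) := Mop (usc_env u).

Definition Mminus (u : state R d dq -> R) := Mop (lsc_env u).

Definition C1 (V : normedModType R) (F : V -> R) : Prop :=
  (forall z, differentiable F z) /\
  (forall v, continuous (fun z => 'd F z v : R)).

(* Test functions are defined and C^1 on [X * R * R] for each [q]: at the
   boundary of [Obar] this is the C^1-up-to-the-boundary convention. *)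
Definition test_fun (psi : state R d dq -> R) : Prop :=
  forall q : Q, C1 (fun y : X * R * R => psi (y.1.1, q, y.1.2, y.2)).

Definition dpsi_s (psi : state R d dq -> R) (x : X) (q : Q) (p s : R) : R :=
  derive1 (fun r : R => psi (x, q, p, r)) s.

Definition dpsi_p (psi : state R d dq -> R) (x : X) (q : Q) (p s : R) : R :=
  derive1 (fun r : R => psi (x, q, r, s)) p.

Definition grad_x (psi : state R d dq -> R) (x : X) (q : Q) (p s : R) : X :=
  \row_(i < d) 'D_(delta_mx 0 i) (fun y : X => psi (y, q, p, s)) x.

(* Local extrema relative to [Obar]. *)
Definition loc_max (v : state R d dq -> R) (z : state R d dq) : Prop :=
  \forall z' \near within Obar (nbhs z), v z' <= v z.

Definition loc_min (v : state R d dq -> R) (z : state R d dq) : Prop :=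
  \forall z' \near within Obar (nbhs z), v z <= v z'.

Variables (phi varphi : X -> R).

Definition subsolution (u : state R d dq -> R) : Prop :=
  forall psi, test_fun psi ->
  forall (x : X) (q : Q) (p s : R), Obar (x, q, p, s) ->
  loc_max (fun z => u z - psi z) (x, q, p, s) ->
  [/\ Omega (x, q, p, s) ->
      (Order.min ((dpsi_s psi x q p s + dpsi_p psi x q p s)%:E
                  + Ham s x q (grad_x psi x q p s))
                 (u (x, q, p, s) - varphi x)%:E <= 0)%E,
      p = 0 -> ((u (x, q, p, s))%:E <= Mplus u x q s)%E &
      s = 0 -> u (x, q, p, s) <= Num.max (phi x) (varphi x)].

Definition supersolution (u : state R d dq -> R) : Prop :=
  forall psi, test_fun psi ->
  forall (x : X) (q : Q) (p s : R), Obar (x, q, p, s) ->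
  loc_min (fun z => u z - psi z) (x, q, p, s) ->
  [/\ Omega (x, q, p, s) ->
      (0 <= Order.min ((dpsi_s psi x q p s + dpsi_p psi x q p s)%:E
                       + Ham s x q (grad_x psi x q p s))
                      (u (x, q, p, s) - varphi x)%:E)%E,
      p = 0 -> (Mminus u x q s <= (u (x, q, p, s))%:E)%E &
      s = 0 -> Num.max (phi x) (varphi x) <= u (x, q, p, s)].

Definition hypH1 : Prop :=
  exists2 Lf : R, 0 < Lf &
    forall (s : R) (y y' : X) (q : Q) (v : 'rV[R]_m), 0 <= s -> U q v ->
      enorm (f s y v q - f s y' v q) <= Lf * enorm (y - y') /\
      enorm (f s y v q) <= Lf.

Definition hypH2 : Prop :=
  (forall q : Q,
     {within [set z : R * X * 'rV[R]_m | 0 <= z.1.1 /\ U q z.2],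
      continuous (fun z => f z.1.1 z.1.2 z.2 q)}) /\
  (forall (s : R) (x : X) (v : 'rV[R]_m), 0 <= s ->
     {within [set q : Q | U q v], continuous (f s x v)}).

Definition hypH3 : Prop :=
  forall (s : R) (y : X) (q : Q), 0 <= s <= t ->
    @convex_set R X [set f s y v q | v in U q].

Definition hypH4 : Prop :=
  exists2 Lg : R, 0 < Lg &
    forall (q w : Q), W q w -> `|(nat_of_ord (g w q))%:R : R| <= Lg.

Definition hypH5 : Prop :=
  {within [set wq : Q * Q | W wq.2 wq.1],
   continuous (fun wq : Q * Q => g wq.1 wq.2)}.

End Problem.

Definition truncate (R : realType) (T : Type) (LK : R) (h : T -> R) (x : T) : R :=
  Num.max (Num.min (h x) LK) (- LK).

(* Main.v *)
Require Import Defs.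
From HB Require Import structures.
From mathcomp Require Import all_boot all_order all_algebra.
From mathcomp Require Import all_classical all_reals all_analysis.
From mathcomp Require Import measurable_realfun.
From mathcomp Require Import ring lra.

Set Implicit Arguments.
Unset Strict Implicit.
Unset Printing Implicit Defensive.

Import Order.TTheory GRing.Theory Num.Theory.
Import numFieldNormedType.Exports.

Local Open Scope classical_set_scope.
Local Open Scope ring_scope.

(* The Hamiltonian [H s x q z] is Lipschitz in [x] and in [z], but, since [U q]
   need not be compact, only lower semicontinuous in [s], so that doubling the
   time variable does not give a contradiction at a single contact point.

   Steep penalizations turn the generalized boundary conditions into pointwise
   ones, and show that [W q] and [U q] are nonempty.  As [u1 - u2] at [p = 0] is
   bounded by [u1 - u2] at some [p' >= delta], adding [b * p] to [u1 - u2] makes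
   the supremum unattained at [p = 0], and it is enough to compare at a fixed
   [q].  There, let [mu r] be the minimum of the doubled functional over the
   times [s' <= r] of [u2].  The viscosity inequalities make [mu] nonincreasing,
   Lipschitz with a constant [K] independent of the penalization of
   [s - s'], and forbid [mu' < 0] except at the times at which [H] exceeds by
   too much its values at neighbouring times.  Lower semicontinuity of [H] makes
   the set of these exceptional times of small measure when the neighbourhoods
   shrink, so that the total decrease of [mu] is as small as desired. *)

(** The exceptional times are times of [u2]. Subtracting the two inequalities at a doubled contact
    sets the Hamiltonian at the time [s] of [u1] against the one at the time [s'] of [u2], and lower
    semicontinuity at [s'] bounds the latter by the former plus an error once [s] is close to [s'].
    How close depends on [s'], with no uniformity; a single scale works only off a set of small
    measure, and it must be fixed before the penalization of [s - s']. Hence the need for a slope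
    bound [K] that depends on the space penalization alone.

    Knowing [mu' >= 0] at most times bounds the decrease of [mu] only if [mu] is absolutely
    continuous, which is what its Lipschitz bound provides. Test functions must be C^1 while [mu] is
    only differentiable at such times, so a C^1 function touching [- mu] from above has to be built.

    The strict gain comes from [2 * b * s - b * p]: its derivative along [s] and [p] together is
    [b > 0], although the sign of the [p] term, dictated by the switch, is unfavourable. *)

(** * Growth of a Lipschitz function with nonpositive derivative on a set *)

Section Growth.
Context (R : realType).
Local Notation mu := (@lebesgue_measure R).

Lemma continuous_of_increments (F : R -> R) (K : R) :
  (forall x y, x <= y -> 0 <= F y - F x <= K * (y - x)) -> 0 <= K -> continuous F.
Proof.
move=> FK K0 x; apply/cvgrPdist_le => e e0; near=> y.
have h : `|F x - F y| <= K * `|x - y|.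
  have [xy|yx] := leP x y.
    have /andP[h1 h2] := FK _ _ xy.
    by rewrite distrC ger0_norm// distrC [`|y - x|]ger0_norm// subr_ge0.
  have /andP[h1 h2] := FK _ _ (ltW yx).
  by rewrite ger0_norm// [`|x - y|]ger0_norm// subr_ge0 ltW.
apply: (le_trans h); apply: (@le_trans _ _ (K * (e / (K + 1)))).
  apply: ler_wpM2l => //; near: y; apply: cvgr_dist_le; first exact: cvg_id.
  by rewrite divr_gt0// ltr_pwDr.
rewrite mulrA ler_pdivrMr ?ltr_pwDr//; nra.
Unshelve. all: by end_near. Qed.

Lemma isCumulative_of_increments (F : R -> R) (K : R) :
  (forall x y, x <= y -> 0 <= F y - F x <= K * (y - x)) -> 0 <= K -> isCumulative R _ R F.
Proof.
move=> FK K0; split.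
  by move=> x y /FK/andP[]; rewrite subr_ge0.
by apply: right_continuousW; exact: continuous_of_increments FK K0.
Qed.

(** Both [F] and [K * x - F x] are cumulative, and their Stieltjes measures add up to that of
    [K * x], which is [K] times Lebesgue measure. *)
Lemma measure_bound_of_lipschitz (F : R -> R) (K : R) :
  (forall x y, x <= y -> 0 <= F y - F x <= K * (y - x)) -> 0 <= K ->
  exists nu : {measure set (measurableTypeR R) -> \bar R},
    (forall x y, x <= y -> nu `]x, y]%classic = (F y - F x)%:E) /\
    (forall A, measurable A -> (nu A <= K%:E * mu A)%E).
Proof.
move=> FK K0.
pose F1 : cumulative R R := HB.pack F (isCumulative_of_increments FK K0).
have GK : forall x y, x <= y -> 0 <= (K * y - F y) - (K * x - F x) <= K * (y - x).
  move=> x y xy; have /andP[h1 h2] := FK _ _ xy; apply/andP; split; lra.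
pose G2 := fun x => K * x - F x.
pose F2 : cumulative R R := HB.pack G2 (isCumulative_of_increments GK K0).
have HK : forall x y, x <= y -> 0 <= K * y - K * x <= K * (y - x).
  move=> x y xy; apply/andP; split; nra.
pose G3 := fun x => K * x.
pose F3 : cumulative R R := HB.pack G3 (isCumulative_of_increments HK K0).
have nuE (F' : cumulative R R) x y : x <= y ->
    lebesgue_stieltjes_measure F' `]x, y]%classic = (F' y - F' x)%:E.
  move=> xy; rewrite /lebesgue_stieltjes_measure /measure_extension measurable_mu_extE/=.
    by rewrite wlength_itv_bnd.
  exact: is_ocitv.
exists (lebesgue_stieltjes_measure F1); split; first by move=> x y; exact: nuE.
move=> A mA.
have e1 : lebesgue_stieltjes_measure F3 A =
    (lebesgue_stieltjes_measure F1 A + lebesgue_stieltjes_measure F2 A)%E.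
  pose m F' : {measure set (measurableTypeR R) -> \bar R} := lebesgue_stieltjes_measure F'.
  rewrite -(measure_addE (m F1) (m F2)); apply: lebesgue_stieltjes_measure_unique => // X /ocitvP[->|[x x12 ->]].
    by rewrite !measure0.
  by rewrite [RHS](measure_addE (m F1) (m F2)) /m/= !nuE ?ltW//= -EFinD /G2 /G3; congr (_%:E); ring.
have e2 : lebesgue_stieltjes_measure F3 A = (K%:E * mu A)%E.
  have -> : (K%:E * mu A)%E = mscale (NngNum K0) mu A by [].
  apply: lebesgue_stieltjes_measure_unique => // X /ocitvP[->|[x x12 ->]].
    by rewrite !measure0.
  transitivity (K%:E * lebesgue_stieltjes_measure idfun `]x.1, x.2]%classic)%E; last by [].
  by rewrite !nuE ?ltW// -EFinM /= /G3 mulrBr.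
by rewrite -e2 e1 leeDl// measure_ge0.
Qed.

Lemma derive1_shift (F G : R -> R) (x c : R) :
  (\forall y \near x, F y = G y + c) -> derivable G x 1 ->
  derivable F x 1 /\ derive1 F x = derive1 G x.
Proof.
move=> FG dG; have dc := is_derive_cst c x (1 : R).
have dG' : is_derive x (1 : R) G (derive1 G x) by split => //; rewrite derive1E.
have GF : \forall y \near x, (G + cst c) y = F y by near do apply/esym.
by have [dF DF] := near_eq_is_derive GF (is_deriveD dG' dc); rewrite derive1E DF addr0.
Unshelve. all: by end_near. Qed.

Local Open Scope ereal_scope.

(** The Stieltjes measure of [F] on []0, t]] has a density [h] with respect to Lebesgue measure.
    Differentiating its primitive identifies [h] a.e. with the derivative of [F], so [h <= 0] a.e.
    on [E], and only the complement of [E] contributes, at rate at most [K]. *)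
Lemma lipschitz_growth_le (F : R -> R) (K t : R) (E : set R) :
  (forall x y, x <= y -> 0 <= F y - F x <= K * (y - x))%R -> (0 <= K)%R -> (0 <= t)%R ->
  measurable (E : set (measurableTypeR R)) ->
  (forall s, E s -> derivable F s 1 -> derive1 F s <= 0)%R ->
  (F t - F 0)%:E <= K%:E * mu (`]0%R, t]%classic `\` E).
Proof.
move=> FK K0 t0 mE EF.
have [nu0 [nu0E nu0K]] := measure_bound_of_lipschitz FK K0.
pose D := (`]0%R, t]%classic : set (measurableTypeR R)).
have mD : measurable D by exact: measurable_itv.
have Doo : nu0 D < +oo by rewrite nu0E// ltry.
pose nu : {finite_measure set (measurableTypeR R) -> \bar R} := mfrestr mD Doo.
have nuE A : nu A = nu0 (A `&` D) by [].
have nuK A : measurable A -> nu A <= K%:E * mu A.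
  move=> mA; rewrite nuE (le_trans (nu0K _ _))//; first exact: measurableI.
  by apply: lee_wpmul2l => //; apply: le_measure; rewrite ?inE//; exact: measurableI.
have dom : nu `<< mu.
  apply/null_content_dominatesP => A mA A0; apply/eqP; rewrite eq_le measure_ge0 andbT.
  by rewrite (le_trans (nuK _ mA))// A0 mule0.
have [h [h0 hfin hint hE]] := @radon_nikodym_sigma_finite _ _ _ mu nu dom.
pose k := fine \o h.
have kE : EFin \o k = h by apply/funext => x /=; rewrite fineK.
have i1 y : mu.-integrable [set` Interval (BRight 0%R) (BRight y)] (EFin \o k).
  by rewrite kE; apply: integrableS hint => //; exact: measurable_itv.
have i2 : locally_integrable [set: R] k.
  by apply: open_integrable_locally; [exact: openT|rewrite kE].
have := FTC1 i1 i2.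
set G := (fun _ => _) => aeG.
have GE y : (0 <= y <= t)%R -> G y = (F y - F 0)%R.
  move=> /andP[y0 yt]; rewrite /G /Rintegral; under eq_integral do rewrite -[(k _)%:E]/((EFin \o k) _) kE.
  rewrite -hE; last exact: measurable_itv.
  rewrite nuE setIidl ?nu0E//.
  by move=> x; rewrite /D/= !in_itv/= => /andP[-> /le_trans]; apply.
move: aeG; cbv zeta => aeG; clearbody G.
have aeh : {ae mu, forall x, (E `&` D) x -> h x <= 0}.
  (* The endpoint [t] is discarded: the primitive equals [F - F 0] on [[0, t]] only, and a
     derivative needs a two-sided neighbourhood. *)
  have ne1 : {ae mu, forall x : measurableTypeR R, x != t}.
    exists [set t]; split => //; first exact: lebesgue_measure_set1.
    by move=> x /= /negP; rewrite negbK => /eqP.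
  move: aeG; apply: filterS2 ne1 => x xt /= H [Ex].
  rewrite /D /= in_itv/= => /andP[x0 x_t]; have {H} [dG Gk] := H (x0 : (BRight 0%R < BRight x)%O).
  have FG : \forall y \near x, F y = (G y + F 0)%R.
    have xt' : (x < t)%R by rewrite lt_neqAle xt.
    near=> y; rewrite GE ?subrK//; apply/andP; split; apply: ltW; near: y.
      exact: lt_nbhsr.
    exact: lt_nbhsl.
  have [dF DF] := derive1_shift FG dG.
  have := EF _ Ex dF; rewrite DF Gk => kx.
  by rewrite -[h x]fineK// lee_fin.
have mDE : measurable (D `\` E) by exact: measurableD.
have mED : measurable (E `&` D) by exact: measurableI.
have EDE : (E `&` D) `|` (D `\` E) = D.
  by rewrite setDE setIC -setIUr setUCr setIT.
have dis : (E `&` D) `&` (D `\` E) = set0.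
  by apply/seteqP; split => // x [[Ex _] [_ /(_ Ex)]].
have nuD : nu D = (F t - F 0)%:E by rewrite nuE setIid nu0E.
have ED0 : nu (E `&` D) <= 0.
  rewrite (hE _ mED).
  have mh := measurable_funS measurableT (@subsetT _ (E `&` D)) (measurable_int _ hint).
  have := @ae_ge0_le_integral _ _ _ mu _ mED h (cst 0) (fun x _ => h0 x) mh.
  by move=> /(_ (fun _ _ => lexx 0) (measurable_cst _) aeh); rewrite integral0.
rewrite -nuD -EDE (measureU nu mED mDE dis) -[leRHS]add0e.
exact: leeD ED0 (nuK _ mDE).
Unshelve. all: by end_near. Qed.

End Growth.

(** * C^1 functions touching from above at a point of differentiability *)

Section ContactFromDerivative.
Context (R : realType).
Implicit Types (g : R -> R) (C : R).

(** The plain supremum of [g] over [|j| <= 2 * |k|] can jump as [k] varies. The weight is 1 on that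
    range and decays like [1 / |j|] beyond it, which restores continuity. The factor 2 serves the
    integration over [[h / 2, h]] in [C1_upper_contact]. *)
Definition modulus g (k : R) : R :=
  sup [set g j * Num.min 1 (2 * `|k| / `|j|) | j in [set j | j != 0]].

Section Modulus.
Variables (g : R -> R) (C : R).
Hypothesis g_ge0 : forall j, 0 <= g j.
Hypothesis g_leC : forall j, g j <= C.
Hypothesis g_cvg0 : forall e, 0 < e -> exists2 r, 0 < r & forall j, `|j| < r -> g j <= e.

Lemma min1_ge0 (k j : R) : 0 <= Num.min 1 (2 * `|k| / `|j|).
Proof. by rewrite le_min ler01 mulr_ge0// mulr_ge0. Qed.

Lemma modulus_ub k j : j != 0 -> g j * Num.min 1 (2 * `|k| / `|j|) <= modulus g k.
Proof.
move=> j0; apply: ub_le_sup; last by exists j.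
exists C => _ [i _ <-]; apply: le_trans (g_leC i).
by apply: ler_piMr => //; rewrite ge_min lexx.
Qed.

Lemma modulus_le k c :
  (forall j, j != 0 -> g j * Num.min 1 (2 * `|k| / `|j|) <= c) -> modulus g k <= c.
Proof.
move=> H; apply: ge_sup; last by move=> _ [j j0 <-]; exact: H.
by exists (g 1 * Num.min 1 (2 * `|k| / `|1|)); exists 1 => //; exact: oner_neq0.
Qed.

Lemma modulus_ge0 k : 0 <= modulus g k.
Proof.
apply: le_trans (modulus_ub k (oner_neq0 R)).
by rewrite mulr_ge0// min1_ge0.
Qed.

Lemma modulus_leC k : modulus g k <= C.
Proof.
apply: modulus_le => j j0; apply: le_trans (g_leC j).
by apply: ler_piMr => //; rewrite ge_min lexx.
Qed.

Lemma modulus0 : modulus g 0 = 0.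
Proof.
apply/eqP; rewrite eq_le modulus_ge0 andbT; apply: modulus_le => j j0.
rewrite normr0 mulr0 mul0r; have -> : Num.min (1 : R) 0 = 0.
  by apply/min_idPr.
by rewrite mulr0.
Qed.

Lemma modulus_homo k k' : `|k| <= `|k'| -> modulus g k <= modulus g k'.
Proof.
move=> kk; apply: modulus_le => j j0; apply: le_trans (modulus_ub k' j0).
apply: ler_wpM2l => //; rewrite le_min ge_min lexx/= ge_min; apply/orP; right.
by apply: ler_wpM2r; rewrite ?invr_ge0// ler_wpM2l.
Qed.

Lemma modulus_dominates k j : j != 0 -> `|j| <= 2 * `|k| -> g j <= modulus g k.
Proof.
move=> j0 jk; apply: le_trans (modulus_ub k j0).
have -> : Num.min 1 (2 * `|k| / `|j|) = 1.
  by apply/min_idPl; rewrite ler_pdivlMr ?normr_gt0// mul1r.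
by rewrite mulr1.
Qed.

(** Passing from [k] to [k'] multiplies each weight by at most [1 + |k' - k| / |k|]; the bound [C]
    on the supremum turns this factor into an additive error. *)
Lemma modulus_increment k k' : k != 0 ->
  modulus g k' <= modulus g k + C * (`|k' - k| / `|k|).
Proof.
move=> k0; apply: modulus_le => j j0.
have n0 : 0 < `|k| by rewrite normr_gt0.
set eta := `|k' - k| / `|k|; have eta0 : 0 <= eta by rewrite divr_ge0.
have kk' : `|k'| <= `|k| * (1 + eta).
  rewrite mulrDr mulr1 /eta mulrCA divff ?gt_eqF// mulr1.
  by rewrite -{1}(subrK k k') addrC; exact: ler_normD.
apply: (@le_trans _ _ (g j * (Num.min 1 (2 * `|k| / `|j|) * (1 + eta)))).
  apply: ler_wpM2l => //; rewrite minr_pMl ?mul1r; last lra.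
  rewrite le_min !ge_min; apply/andP; split; first by rewrite lerDl eta0.
  apply/orP; right; rewrite [leRHS]mulrAC ler_wpM2r ?invr_ge0//.
  by rewrite -mulrA ler_wpM2l.
have h1 := modulus_ub k j0; have h2 := modulus_leC k; have h3 := modulus_ge0 k.
set A := g j * _ in h1; rewrite mulrA -/A; nra.
Qed.

Lemma modulus_continuous : continuous (modulus g).
Proof.
move=> k; have C0 : 0 <= C := le_trans (g_ge0 0) (g_leC 0).
apply/cvgrPdist_le => e e0.
have [->|k0] := eqVneq k 0.
  have [r r0 H] := g_cvg0 e0.
  near=> k'; rewrite modulus0 sub0r normrN ger0_norm ?modulus_ge0//.
  (* Indices with [|j| < r] are handled by the smallness of [g], the others by that of the weight,
     at most [2 * |k'| / r]. *)
  apply: modulus_le => j j0; have [jr|rj] := ltP `|j| r.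
    by apply: le_trans (H _ jr); apply: ler_piMr => //; rewrite ge_min lexx.
  have j1 : 0 < `|j| by rewrite normr_gt0.
  have hk : `|k'| <= e * r / (2 * (C + 1)).
    rewrite -[k']subr0; near: k'; apply: cvgr_distC_le; first exact: cvg_id.
    by rewrite divr_gt0 ?mulr_gt0//; lra.
  apply: (@le_trans _ _ (C * (2 * `|k'| / `|j|))).
    by apply: (ler_pM (g_ge0 j) (min1_ge0 _ _) (g_leC j)); rewrite ge_min lexx orbT.
  rewrite mulrA ler_pdivrMr// (le_trans _ (ler_wpM2l (ltW e0) rj))//.
  move: hk; rewrite ler_pdivlMr; last lra.
  have := normr_ge0 k'; nra.
have n0 : 0 < `|k| by rewrite normr_gt0.
near=> k'.
have hk : `|k' - k| <= `|k| / 2.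
  near: k'; apply: cvgr_distC_le; [exact: cvg_id|lra].
have hk2 : `|k' - k| <= e * `|k| / (2 * (C + 1)).
  near: k'; apply: cvgr_distC_le; [exact: cvg_id|].
  by rewrite divr_gt0 ?mulr_gt0//; lra.
have kk' : `|k| / 2 <= `|k'|.
  have := ler_normD (k - k') k'; rewrite subrK distrC; lra.
have k'0 : k' != 0 by rewrite -normr_gt0; lra.
have h1 := modulus_increment k' k0; have h2 := modulus_increment k k'0.
have hc (x : R) : `|k| / 2 <= x -> C * (`|k' - k| / x) <= e.
  move=> kx; have x0 : 0 < x by lra.
  rewrite mulrA ler_pdivrMr//; move: hk2; rewrite ler_pdivlMr; last lra.
  have := normr_ge0 (k' - k); nra.
have := hc _ kk'; have := hc `|k|; rewrite distrC in h2.
move=> /(_ ltac:(lra)) c1 c2; rewrite ler_norml; apply/andP; split; lra.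
Unshelve. all: by end_near. Qed.

End Modulus.


(** The support condition makes [b] integrable on the line, so that the integral from [-oo] is a
    primitive at every point. *)
Lemma compactly_supported_primitive (b : R -> R) :
  continuous b -> (forall x, 1 <= `|x| -> b x = 0) ->
  exists X : R -> R, forall x, is_derive x (1 : R) X (b x).
Proof.
move=> cb b0; pose I := `[(-1 : R), 1]%classic.
have bE : b = b \_ I.
  apply/funext => x; rewrite patchE; case: ifPn => // /negP xI; apply: b0.
  rewrite leNgt; apply/negP; rewrite ltr_norml => /andP[x1 x2]; apply: xI.
  by rewrite inE /I/= in_itv/= !ltW.
have ib : (@lebesgue_measure R).-integrable setT (EFin \o b).
  have -> : EFin \o b = (EFin \o b) \_ I.
    by rewrite {1}bE; apply/funext => x/=; rewrite !patchE; case: ifPn.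
  rewrite -integrable_mkcond; last exact: measurable_itv.
  apply: continuous_compact_integrable; first exact: segment_compact.
  by apply: continuous_subspaceT.
exists (fun y => (\int[@lebesgue_measure R]_(t in [set` Interval -oo%O (BRight y)]) (b t))%R) => x.
have [||||d1 d2] := @continuous_FTC1 R b -oo%O x (x + 1).
- by rewrite ltrDl.
- by apply: integrableS ib => //; exact: measurable_itv.
- by rewrite ltNyr.
- exact: cb.
by apply: DeriveDef; [exact: d1|rewrite -derive1E; exact: d2].
Qed.

Lemma le_of_derive_ge (X b : R -> R) (x y c : R) :
  (forall x, is_derive x (1 : R) X (b x)) -> x <= y ->
  (forall z, x < z < y -> c <= b z) -> c * (y - x) <= X y - X x.
Proof.
move=> dX xy cb; move: xy; rewrite le_eqVlt => /predU1P[->|xy].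
  by rewrite !subrr mulr0.
have [|z zxy ->] := MVT xy (f := X) (df := b) (fun z _ => dX z).
  by apply: derivable_within_continuous => z _; exact: (@ex_derive _ _ _ _ _ _ _ (dX z)).
by apply: ler_wpM2r; [rewrite subr_ge0 ltW|apply: cb; move: zxy; rewrite in_itv].
Qed.

(** Differentiability at [s] gives a remainder [o(|h|)] with no regularity. It is dominated by the
    primitive of an odd continuous function built from [modulus], which adds neither value nor slope
    at [s]. *)
Lemma C1_upper_contact (F : R -> R) (s C : R) :
  (forall h, `|F (s + h) - F s| <= C * `|h|) -> derivable F s 1 ->
  exists X b : R -> R, [/\ forall x, is_derive x (1 : R) X (b x),
    continuous b, b s = derive1 F s, X s = F s & \forall x \near s, F x <= X x].
Proof.
move=> FC dF; pose a : R := derive1 F s.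
pose rem (h : R) : R := `|F (s + h) - F s - a * h|.
pose g (h : R) : R := rem h / `|h|.
have C0 : 0 <= C by have := FC 1; rewrite normr1 mulr1; exact: le_trans.
have g0 h : 0 <= g h by rewrite divr_ge0// normr_ge0.
have gC (h : R) : g h <= C + `|a|.
  rewrite /g; have [->|h0] := eqVneq h 0; first by rewrite normr0 invr0 mulr0 addr_ge0.
  rewrite ler_pdivrMr ?normr_gt0// (le_trans (ler_normB _ _))// mulrDl normrM.
  by rewrite lerD.
have gcvg (e : R) : 0 < e -> exists2 r, 0 < r & forall j, `|j| < r -> g j <= e.
  move=> e0.
  have H : (fun h => h^-1 * (F (h + s) - F s)) h @[h --> 0^'] --> a.
    rewrite /a derive1E /derive; have := dF; rewrite /derivable.
    rewrite (_ : (fun h => h^-1 *: (F (h *: 1 + s) - F s)) = (fun h => h^-1 * (F (h + s) - F s)))//.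
    by apply/funext => h; rewrite [_ *: 1]mulr1.
  move/cvgrPdist_le : H => /(_ _ e0) /nbhs_ballP[r /= r0 H].
  exists r => // j jr; rewrite /g; have [->|j0] := eqVneq j 0; first by rewrite normr0 invr0 mulr0 ltW.
  have := H j; rewrite /ball/= sub0r normrN => /(_ jr j0).
  rewrite ler_pdivrMr ?normr_gt0// /rem.
  have -> : F (s + j) - F s - a * j = - (j * (a - j^-1 * (F (j + s) - F s))).
    by rewrite [s + j]addrC mulrBr mulVKf//; ring.
  by rewrite normrN normrM (mulrC e) => h; apply: ler_wpM2l.
pose cut (h : R) : R := Num.max 0 (1 - `|h|).
pose W := modulus g.
(* Oddness makes the primitive grow on both sides of 0. Since [cut >= 1 / 2] for [|h| <= 1 / 2], the
   factor 4 leaves a slope of at least [2 * W] there. *)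
pose b0 (h : R) : R := 4 * (W (Num.max h 0) - W (Num.max (- h) 0)) * cut h.
have W00 : W 0 = 0 by exact: modulus0 g0 gC.
have cW : continuous W by exact: modulus_continuous g0 gC gcvg.
have ccut : continuous cut.
  move=> h; apply: (@continuous_max R R (cst 0) (fun z : R => 1 - `|z|)); first exact: cst_continuous.
  by apply: (@continuousB R R R (cst 1) (@Num.norm _ R)); [exact: cst_continuous|exact: norm_continuous].
have cb0 : continuous b0.
  suff cd : continuous (fun h : R => W (Num.max h 0) - W (Num.max (- h) 0)).
    by move=> h; apply: cvgM; [apply: cvgM; [exact: cvg_cst|exact: cd]|exact: ccut].
  have cm (k : R -> R) : continuous k -> continuous (fun h : R => W (Num.max (k h) 0)).
    move=> ck z; apply: (@continuous_comp _ _ _ (fun h => Num.max (k h) 0) W); last exact: cW.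
    by apply: (@continuous_max R R k (cst 0)); [exact: ck|exact: cst_continuous].
  move=> h; apply: cvgB; apply: cm => z; first exact: cvg_id.
  by apply: cvgN; exact: cvg_id.
have b0out x : 1 <= `|x| -> b0 x = 0.
  move=> x1; rewrite /b0 /cut; have -> : Num.max 0 (1 - `|x|) = 0.
    by apply/max_idPl; rewrite subr_le0.
  by rewrite mulr0.
have [Y dY] := compactly_supported_primitive cb0 b0out.
pose X (x : R) : R := F s + a * (x - s) + (Y (x - s) - Y 0).
exists X, (fun x => a + b0 (x - s)).
have W0 h : 0 <= W h by exact: modulus_ge0 g0 gC _.
have W1 h k : `|k| <= 2 * `|h| -> `|F (s + k) - F s - a * k| <= W h * `|k|.
  have [->|k0] := eqVneq k 0; first by rewrite addr0 mulr0 !subrr normr0 mulr0.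
  by move=> kh; rewrite -ler_pdivrMr ?normr_gt0//; exact: modulus_dominates g0 gC _ _ k0 kh.
have Wmono h k : `|k| <= `|h| -> W k <= W h by exact: modulus_homo g0 gC _ _.
have WN h : W (- h) = W h by rewrite /W /modulus normrN.
have b0p h k : 0 <= k -> k <= h -> h <= 1 / 2 -> 2 * W k <= b0 h.
  move=> k0 kh h1; rewrite /b0 /cut (ger0_norm (le_trans k0 kh)).
  have -> : Num.max h 0 = h by apply/max_idPl; exact: le_trans kh.
  have -> : Num.max (- h) 0 = 0 by apply/max_idPr; lra.
  have -> : Num.max 0 (1 - h) = 1 - h by apply/max_idPr; lra.
  have h0 := le_trans k0 kh; have Wk : W k <= W h by apply: Wmono; rewrite !ger0_norm.
  have := W0 h; rewrite W00 subr0; nra.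
have b0n h k : 0 <= k -> k <= - h -> - h <= 1 / 2 -> b0 h <= - (2 * W k).
  move=> k0 kh h1; have := b0p (- h) k k0 kh h1; rewrite /b0 /cut normrN opprK.
  by rewrite -[W (Num.max (- h) 0) - _]opprB mulrN mulNr; lra.
split.
- move=> x.
  have dh : is_derive x (1 : R) (fun x : R => x - s) 1.
    by apply: is_derive_eq; rewrite subr0.
  have dYs : is_derive x (1 : R) (fun x : R => Y (x - s)) (b0 (x - s)).
    have := @is_derive1_comp _ Y (fun x : R => x - s) x _ _ (dY _) dh.
    by rewrite mulr1.
  rewrite /X; apply: is_derive_eq.
  by rewrite add0r mul1r subr0; congr (_ + _); exact: mulr1.
- move=> x; apply: cvgD; first exact: cvg_cst.
  apply: (@continuous_comp _ _ _ (fun x : R => x - s) b0); last exact: cb0.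
  by apply: cvgB; [exact: cvg_id|exact: cvg_cst].
- by rewrite subrr /b0 oppr0 subrr mulr0 mul0r addr0.
- by rewrite /X !subrr mulr0 !addr0.
near=> x; rewrite /X.
have xs : `|x - s| <= 1 / 2.
  near: x; apply: cvgr_distC_le; [exact: cvg_id|lra].
pose h := x - s; have xE : x = s + h by rewrite /h; ring.
rewrite -/h; have -> : F x = F (s + h) by rewrite -xE.
(* The remainder at [h] is at most [W (h / 2) * |h|]. Between [h / 2] and [h], a length [|h| / 2],
   the slope is at least [2 * W (h / 2)] in absolute value, which is just enough. *)
have := W1 (h / 2) h; rewrite normrM [`|2^-1|]ger0_norm; last by rewrite invr_ge0.
rewrite mulrCA divff ?pnatr_eq0// mulr1 lexx => /(_ isT) => H.
have := ler_norm (F (s + h) - F s - a * h).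
suff : W (h / 2) * `|h| <= Y h - Y 0 by lra.
have [h0|h0] := leP 0 h.
  have e1 : 0 * (h / 2 - 0) <= Y (h / 2) - Y 0.
    apply: (le_of_derive_ge dY); first lra.
    move=> z /andP[z1 z2]; apply: le_trans (b0p z 0 _ _ _); rewrite ?W00 ?mulr0//.
      exact: ltW.
    move: xs; rewrite -/h ger0_norm//; lra.
  have e2 : 2 * W (h / 2) * (h - h / 2) <= Y h - Y (h / 2).
    apply: (le_of_derive_ge dY); first lra.
    move=> z /andP[z1 z2]; apply: b0p; [lra|exact: ltW|].
    move: xs; rewrite -/h ger0_norm//; lra.
  rewrite ger0_norm//; nra.
have h2 : - h <= 1 / 2 by move: xs; rewrite -/h ltr0_norm.
have dYN z : is_derive z (1 : R) (fun z => - Y z) (- b0 z) by exact: is_deriveN.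
have e1 : 0 * (0 - h / 2) <= - Y 0 - - Y (h / 2).
  apply: (le_of_derive_ge dYN); first lra.
  move=> z /andP[z1 z2]; have := b0n z 0; rewrite W00 mulr0 oppr0 lexx => /(_ isT).
  lra.
have e2 : 2 * W (h / 2) * (h / 2 - h) <= - Y (h / 2) - - Y h.
  apply: (le_of_derive_ge dYN); first lra.
  move=> z /andP[z1 z2]; have := b0n z (- (h / 2)); rewrite WN; lra.
rewrite ltr0_norm//; nra.
Unshelve. all: by end_near. Qed.

End ContactFromDerivative.

(** * Closure properties of C^1 functions *)

Section C1Closure.
Context (R : realType) (V : normedModType R).
Implicit Types F G : V -> R.

Lemma C1_cst (c : R) : C1 (cst c : V -> R).
Proof.
split=> [z|v]; first exact: differentiable_cst.
rewrite (_ : (fun z => _) = cst 0); first exact: cst_continuous.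
by apply/funext => z; rewrite diff_cst.
Qed.

Lemma C1_continuous F : C1 F -> continuous F.
Proof. by move=> [dF _] z; exact: differentiable_continuous. Qed.

Lemma C1D F G : C1 F -> C1 G -> C1 (fun z => F z + G z).
Proof.
move=> [dF cF] [dG cG]; split=> [z|v]; first exact: differentiableD.
have -> : (fun z => 'd (fun z => F z + G z) z v) = fun z => 'd F z v + 'd G z v.
  by apply/funext => z; rewrite (diffD (dF z) (dG z)).
by move=> z; apply: cvgD; [exact: cF|exact: cG].
Qed.

Lemma C1M F G : C1 F -> C1 G -> C1 (fun z => F z * G z).
Proof.
move=> F1 G1; have [dF cF] := F1; have [dG cG] := G1.
split=> [z|v]; first exact: differentiableM.
have -> : (fun z => 'd (fun z => F z * G z) z v) = fun z => F z * 'd G z v + G z * 'd F z v.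
  by apply/funext => z; rewrite (diffM (dF z) (dG z)).
have c1 := C1_continuous F1; have c2 := C1_continuous G1; move=> z.
exact: cvgD (cvgM (c1 z) (cG v z)) (cvgM (c2 z) (cF v z)).
Qed.

Lemma C1_sum n (F : 'I_n -> V -> R) : (forall i, C1 (F i)) -> C1 (fun z => \sum_(i < n) F i z).
Proof.
elim: n F => [|n IH] F CF.
  rewrite (_ : (fun _ => _) = cst 0); first exact: C1_cst.
  by apply/funext => z; rewrite big_ord0.
rewrite (_ : (fun _ => _) = fun z => F ord0 z + \sum_(i < n) F (lift ord0 i) z).
  exact: (@C1D _ (fun z => \sum_(i < n) F (lift ord0 i) z) (CF ord0) (IH _ (fun i => CF _))).
by apply/funext => z; rewrite big_ord_recl.
Qed.

Lemma C1_linear (F : {linear V -> R}) : continuous F -> C1 F.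
Proof.
move=> cF; split=> [z|v]; first exact: linear_differentiable.
have -> : (fun z => 'd F z v) = cst (F v) by apply/funext => z; rewrite (diff_lin _ cF).
exact: cst_continuous.
Qed.

Lemma C1_comp (k k' : R -> R) F :
  (forall x, is_derive x (1 : R) k (k' x)) -> continuous k' -> C1 F -> C1 (fun z => k (F z)).
Proof.
move=> dk ck F1; have [dF cF] := F1.
have Dk x : differentiable k x.
  by apply/derivable1_diffP; have := dk x; case.
split=> [z|v]; first exact: (differentiable_comp (dF z) (Dk (F z))).
have -> : (fun z => 'd (fun z => k (F z)) z v) = fun z => 'd F z v * k' (F z).
  apply/funext => z; rewrite (diff_comp (dF z) (Dk (F z)))/= diff1E//=.
  by rewrite derive1E derive_val.
move=> z; apply: cvgM; first exact: cF.
by apply: continuous_comp; [exact: C1_continuous|exact: ck].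
Qed.

End C1Closure.

(** * The family of test functions and its derivatives *)

Section QuadraticTest.
Context (R : realType) (d : nat).
Local Notation X := 'rV[R]_d.

(** One shape for all the test functions: [A] depends on time to carry the exponential weight of the
    doubling, [B] is general so that it can include a one-variable contact function, and [c]
    confines the space variable. *)
Definition quad (A P B : R -> R) (c : R) (a : X) (y : X * R * R) : R :=
  A y.2 * dotp (y.1.1 - a) (y.1.1 - a) + c * dotp y.1.1 y.1.1 + P y.1.2 + B y.2.

Lemma C1_fst : C1 (fun y : X * R * R => y.1.2).
Proof.
have l : linear (fun y : X * R * R => y.1.2 : R) by move=> k u v.
pose L : {linear (X * R * R)%type -> R} := HB.pack (fun y : X * R * R => y.1.2 : R) (GRing.isLinear.Build _ _ _ _ _ l).
by apply: (@C1_linear _ _ L) => z; apply: continuous_comp; [exact: cvg_fst|exact: cvg_snd].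
Qed.

Lemma C1_snd : C1 (fun y : X * R * R => y.2).
Proof.
have l : linear (fun y : X * R * R => y.2 : R) by move=> k u v.
pose L : {linear (X * R * R)%type -> R} := HB.pack (fun y : X * R * R => y.2 : R) (GRing.isLinear.Build _ _ _ _ _ l).
by apply: (@C1_linear _ _ L) => z; exact: cvg_snd.
Qed.

Lemma C1_coord i : C1 (fun y : X * R * R => y.1.1 0 i).
Proof.
have l : linear (fun y : X * R * R => y.1.1 0 i : R) by move=> k u v; rewrite !mxE.
pose L : {linear (X * R * R)%type -> R} := HB.pack (fun y : X * R * R => y.1.1 0 i : R) (GRing.isLinear.Build _ _ _ _ _ l).
apply: (@C1_linear _ _ L) => z.
apply: (@continuous_comp _ _ _ (fun y : X * R * R => y.1.1) (fun x : X => x 0 i)).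
  by apply: continuous_comp; exact: cvg_fst.
exact: coord_continuous.
Qed.

Lemma C1_quad (A P B A' P' B' : R -> R) (c : R) (a : X) :
  (forall x, is_derive x (1 : R) A (A' x)) -> continuous A' ->
  (forall x, is_derive x (1 : R) P (P' x)) -> continuous P' ->
  (forall x, is_derive x (1 : R) B (B' x)) -> continuous B' ->
  C1 (quad A P B c a).
Proof.
move=> dA cA dP cP dB cB.
have sq (b : X) : C1 (fun y : X * R * R => dotp (y.1.1 - b) (y.1.1 - b)).
  apply: C1_sum => i.
  have cb : C1 (fun y : X * R * R => (y.1.1 - b) 0 i).
    rewrite (_ : (fun _ => _) = fun y : X * R * R => y.1.1 0 i + (- b 0 i)).
      by apply: C1D; [exact: C1_coord|exact: C1_cst].
    by apply/funext => y; rewrite !mxE.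
  exact: C1M.
have sq0 : C1 (fun y : X * R * R => dotp y.1.1 y.1.1).
  rewrite (_ : (fun _ => _) = fun y : X * R * R => dotp (y.1.1 - 0) (y.1.1 - 0)); first exact: sq.
  by apply/funext => y; rewrite subr0.
apply: C1D; last exact: (C1_comp dB cB C1_snd).
apply: C1D; last exact: (C1_comp dP cP C1_fst).
apply: C1D; first exact: (C1M (C1_comp dA cA C1_snd) (sq a)).
by apply: (C1M _ sq0); exact: C1_cst.
Qed.

Lemma quad_dp (A P B P' : R -> R) (c : R) (a x : X) (p s : R) :
  (forall x, is_derive x (1 : R) P (P' x)) ->
  derive1 (fun r => quad A P B c a (x, r, s)) p = P' p.
Proof.
move=> dP; rewrite derive1E /quad/=.
by rewrite (@derive_val _ _ _ _ _ _ _ (_ : is_derive p (1 : R) _ (0 + P' p + 0))); rewrite add0r addr0.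
Qed.

Lemma quad_ds (A P B A' B' : R -> R) (c : R) (a x : X) (p s : R) :
  (forall x, is_derive x (1 : R) A (A' x)) ->
  (forall x, is_derive x (1 : R) B (B' x)) ->
  derive1 (fun r => quad A P B c a (x, p, r)) s = A' s * dotp (x - a) (x - a) + B' s.
Proof.
move=> dA dB; rewrite derive1E /quad/=; set D := dotp (x - a) _.
have H : is_derive s (1 : R) (fun r : R => A r * D + c * dotp x x + P p + B r) (A' s * D + B' s).
  apply: is_derive_eq.
  by rewrite scaler0 add0r !addr0 [_ *: _]mulrC.
by rewrite derive_val.
Qed.

Lemma quad_grad (A P B : R -> R) (c : R) (a x : X) (p s : R) (i : 'I_d) :
  'D_(delta_mx 0 i) (fun y => quad A P B c a (y, p, s)) x = 2 * A s * (x - a) 0 i + 2 * c * x 0 i.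
Proof.
have co j : is_derive x (delta_mx 0 i : X) (fun y : X => y 0 j) (j == i)%:R.
  have l : linear (fun y : X => y 0 j : R) by move=> k u v; rewrite !mxE.
  pose L : {linear X -> R} := HB.pack (fun y : X => y 0 j : R) (GRing.isLinear.Build _ _ _ _ _ l).
  have cL : continuous L by move=> y; exact: coord_continuous.
  have dL : differentiable L x by exact: linear_differentiable.
  apply: DeriveDef; first exact: diff_derivable.
  by rewrite (deriveE _ dL) (diff_lin _ cL) /L/= mxE eqxx.
have sq (b : X) : is_derive x (delta_mx 0 i : X) (fun y : X => dotp (y - b) (y - b)) (2 * (x - b) 0 i).
  have cob j : is_derive x (delta_mx 0 i : X) (fun y : X => (y - b) 0 j) (j == i)%:R.
    rewrite (_ : (fun _ => _) = (fun y : X => y 0 j) - cst (b 0 j)).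
      by apply: is_derive_eq; rewrite subr0.
    by apply/funext => y; rewrite !mxE.
  rewrite (_ : (fun _ => _) = \sum_(j < d) ((fun y : X => (y - b) 0 j) * (fun y : X => (y - b) 0 j))).
    apply: is_derive_eq; rewrite (bigD1 i)//= eqxx big1 ?addr0.
      by rewrite -[_ *: 1]/(_ * _) mulr1; ring.
    by move=> j /negbTE ->; rewrite scaler0 addr0.
  by apply/funext => y; rewrite /dotp fct_sumE.
have sq0 : is_derive x (delta_mx 0 i : X) (fun y : X => dotp y y) (2 * x 0 i).
  have := sq 0; rewrite subr0 (_ : (fun _ => _) = fun y : X => dotp y y)//.
  by apply/funext => y; rewrite subr0.
have sqa := sq a.
have H : is_derive x (delta_mx 0 i : X) (fun y => quad A P B c a (y, p, s))
    (2 * A s * (x - a) 0 i + 2 * c * x 0 i).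
  rewrite /quad/=; apply: is_derive_eq.
  by rewrite !addr0 -![_ *: _]/(_ * _); ring.
by rewrite derive_val.
Qed.

End QuadraticTest.

(** * Euclidean norm, Cauchy-Schwarz inequality, compact balls *)

Section DotProduct.
Context (R : realType) (d : nat).
Implicit Types x y z : 'rV[R]_d.

Lemma dotpC x y : dotp x y = dotp y x.
Proof. by apply: eq_bigr => i _; rewrite mulrC. Qed.

Lemma dotpDl x y z : dotp (x + y) z = dotp x z + dotp y z.
Proof. by rewrite -big_split; apply: eq_bigr => i _; rewrite mxE mulrDl. Qed.

Lemma dotpZl (k : R) x y : dotp (k *: x) y = k * dotp x y.
Proof. by rewrite mulr_sumr; apply: eq_bigr => i _; rewrite mxE mulrA. Qed.

Lemma dotpNl x y : dotp (- x) y = - dotp x y.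
Proof. by rewrite -scaleN1r dotpZl mulN1r. Qed.

Lemma dotpBl x y z : dotp (x - y) z = dotp x z - dotp y z.
Proof. by rewrite dotpDl dotpNl. Qed.

Lemma dotpZr (k : R) x y : dotp x (k *: y) = k * dotp x y.
Proof. by rewrite dotpC dotpZl dotpC. Qed.

Lemma dotpBr x y z : dotp x (y - z) = dotp x y - dotp x z.
Proof. by rewrite dotpC dotpBl !(dotpC x). Qed.

Lemma dotp_ge0 x : 0 <= dotp x x.
Proof. by apply: sumr_ge0 => i _; rewrite -expr2 sqr_ge0. Qed.

Lemma enorm_ge0 x : 0 <= enorm x. Proof. exact: sqrtr_ge0. Qed.

Lemma enorm_sqr x : enorm x ^+ 2 = dotp x x.
Proof. by rewrite sqr_sqrtr// dotp_ge0. Qed.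

Lemma enormZ (k : R) x : enorm (k *: x) = `|k| * enorm x.
Proof.
by rewrite /enorm dotpZl dotpZr mulrA -expr2 sqrtrM ?sqr_ge0// sqrtr_sqr.
Qed.

Lemma cauchy_schwarz x y : `|dotp x y| <= enorm x * enorm y.
Proof.
rewrite -ler_sqr ?nnegrE ?normr_ge0 ?mulr_ge0 ?enorm_ge0// exprMn !enorm_sqr real_normK ?num_real//.
have := dotp_ge0 (dotp y y *: x - dotp x y *: y).
rewrite dotpBl !dotpBr !dotpZl !dotpZr (dotpC y x).
have := dotp_ge0 y; rewrite le_eqVlt => /predU1P[y0 _|y0].
  have yi i : y 0 i = 0.
    have /psumr_eq0P := esym y0 => /(_ (fun i _ => _)).
    by move=> /(_ (fun i => ltac:(by rewrite -expr2 sqr_ge0)) i isT) /eqP; rewrite mulf_eq0 orbb => /eqP.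
  rewrite /dotp big1 ?expr0n//=; last by move=> i _; rewrite yi mulr0.
  by rewrite mulr_ge0// dotp_ge0.
move=> H; suff : 0 <= dotp y y * (dotp x x * dotp y y - dotp x y ^+ 2).
  by rewrite pmulr_rge0// subr_ge0.
by apply: le_trans H _; rewrite le_eqVlt; apply/orP; left; apply/eqP; ring.
Qed.

Lemma norm_sqr_le_dotp x : `|x| ^+ 2 <= dotp x x.
Proof.
have [->|x0] := eqVneq `|x| 0; first by rewrite expr0n/= dotp_ge0.
have [[i j] /= e] := mx_norm_neq0 x0; rewrite (e : `|x| = _) (ord1 i).
rewrite real_normK ?num_real// /dotp (bigD1 j)//= -expr2 lerDl.
by apply: sumr_ge0 => k _; rewrite -expr2 sqr_ge0.
Qed.

Lemma dotp_continuous (T : topologicalType) (F G : T -> 'rV[R]_d) (z : T) :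
  {for z, continuous F} -> {for z, continuous G} ->
  {for z, continuous (fun w => dotp (F w) (G w))}.
Proof.
move=> cF cG.
have c i (H : T -> 'rV[R]_d) : {for z, continuous H} -> {for z, continuous (fun w => H w 0 i)}.
  by move=> cH; apply: (@continuous_comp _ _ _ H (fun x : 'rV[R]_d => x 0 i) z cH); exact: coord_continuous.
apply: cvg_big => [|i _]; first exact: add_continuous.
exact: cvgM (c i F cF) (c i G cG).
Qed.

Lemma compact_normr_le (r : R) : compact [set y : 'rV[R]_d | `|y| <= r].
Proof.
apply: bounded_closed_compact.
  by exists r; split; [exact: num_real|move=> x rx y /le_trans; apply; exact: ltW].
apply: (@closed_comp _ _ (@Num.norm R 'rV[R]_d) [set x : R | x <= r]); last exact: closed_le.
by move=> y _; exact: norm_continuous.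
Qed.

End DotProduct.

(** * Lower semicontinuity relative to a set *)

Section LowerSemicontinuity.
Context (R : realType) (T : topologicalType).
Implicit Types (D : set T) (h : T -> R).

Definition lsc_in D h := forall z, D z -> forall c, c < h z ->
  \forall z' \near z, D z' -> c < h z'.

Lemma continuous_lsc_in D h : continuous h -> lsc_in D h.
Proof.
move=> ch z _ c hz; near=> z' => _; near: z'.
by apply: (cvgr_gt (h z)) => //; exact: ch.
Unshelve. all: by end_near. Qed.

Lemma lsc_inD D h k : lsc_in D h -> lsc_in D k -> lsc_in D (fun z => h z + k z).
Proof.
move=> lh lk z Dz c; rewrite -ltrBlDr => hk.
have [a /andP[a1 a2]] : exists a, c - k z < a < h z.
  by exists ((c - k z + h z) / 2); rewrite !midf_lt.
have := lh z Dz a a2; have := lk z Dz (c - a) ltac:(lra).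
by apply: filterS2 => z' h1 h2 Dz'; have := h1 Dz'; have := h2 Dz'; lra.
Qed.

Lemma lsc_in_le D D' h : D' `<=` D -> lsc_in D h -> lsc_in D' h.
Proof. by move=> DD lh z D'z c /(lh z (DD _ D'z)); apply: filterS => z' + /DD. Qed.

(** If the infimum [m] were not attained, each point would have a neighbourhood on which
    [h > m + 1 / (n + 1)] for large [n]; compactness makes [n] uniform, against the definition of
    [m]. *)
Lemma lsc_in_compact_min (K : set T) h (C : R) : compact K -> K !=set0 ->
  lsc_in K h -> (forall z, K z -> C <= h z) ->
  exists2 z, K z & forall z', K z' -> h z <= h z'.
Proof.
move=> cK [z0 Kz0] lh hC; set m := inf (h @` K).
have hi : has_inf (h @` K).
  by split; [exists (h z0), z0|exists C => _ [z Kz <-]; exact: hC].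
have mh z : K z -> m <= h z by move=> Kz; apply: inf_lbound; [case: hi|exists z].
apply: contrapT => nomin.
have pos z : K z -> m < h z.
  move=> Kz; rewrite lt_neqAle mh// andbT; apply/eqP => mhz; apply: nomin.
  by exists z => // z' Kz'; rewrite -mhz mh.
have /compact_near_coveringP/near_covering_withinP := cK.
move=> /(_ nat \oo (fun n z => m + n.+1%:R^-1 < h z)) [].
  move=> z Kz; have mz := pos z Kz.
  pose a := (m + h z) / 2; have [a1 a2] : m < a /\ a < h z by rewrite /a; split; lra.
  exists ([set z' | K z' -> a < h z'], [set n | m + n.+1%:R^-1 < a]) => /=.
    split; first exact: lh.
    near=> n => /=; rewrite -ltrBrDl; near: n.
    have am : 0 < a - m by rewrite subr_gt0.
    exact: (near_infty_natSinv_lt (PosNum am)).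
  by move=> [z' n] /= [h1 h2] Kz'; apply: lt_trans h2 (h1 Kz').
move=> n _ /(_ n (leqnn _)) H.
have n0 : 0 < n.+1%:R^-1 :> R by rewrite invr_gt0.
have [_ [z Kz <-] hz] := inf_adherent n0 hi.
by have := lt_trans (H z Kz) hz; rewrite ltxx.
Unshelve. all: by end_near. Qed.

End LowerSemicontinuity.

(** * Times at which the Hamiltonian is almost continuous *)

Section GoodTimes.
Context (R : realType) (d m : nat).
Local Notation X := 'rV[R]_d.
Local Notation mu := (@lebesgue_measure R).

Lemma enorm_continuous : continuous (@enorm R d).
Proof.
move=> x; apply: (@continuous_comp _ _ _ (fun x : X => dotp x x) (@Num.sqrt R)); last exact: sqrt_continuous.
by apply: dotp_continuous; exact: cvg_id.
Qed.

Variables (U : set 'rV[R]_m) (F : R -> X -> 'rV[R]_m -> X) (L : R).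
Hypothesis L_gt0 : 0 < L.
Hypothesis F_lip : forall s y y' v, 0 <= s -> U v ->
  enorm (F s y v - F s y' v) <= L * enorm (y - y').
Hypothesis F_bnd : forall s y v, 0 <= s -> U v -> enorm (F s y v) <= L.
Hypothesis F_cont : forall y v, U v -> continuous (fun s : R => F (Num.max s 0) y v).

Lemma dotpF_le s y y0 v z z0 : 0 <= s -> U v ->
  `|dotp (F s y v) z - dotp (F s y0 v) z0| <= L * enorm (z - z0) + L * enorm (y - y0) * enorm z0.
Proof.
move=> s0 Uv.
have -> : dotp (F s y v) z - dotp (F s y0 v) z0 =
    dotp (F s y v) (z - z0) + dotp (F s y v - F s y0 v) z0.
  by rewrite dotpBr dotpBl; ring.
apply: le_trans (ler_normD _ _) _; apply: lerD.
  by apply: le_trans (cauchy_schwarz _ _) _; rewrite ler_wpM2r ?enorm_ge0// F_bnd.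
by apply: le_trans (cauchy_schwarz _ _) _; rewrite ler_wpM2r ?enorm_ge0// F_lip.
Qed.

(* [s'] is good for the scale [r] when the Hamiltonian at [s'] exceeds the
   Hamiltonian at times closer than [r] by at most [e], uniformly for bounded
   [y] and [z]. *)
Definition good_time (R0 Z e r s' : R) : Prop :=
  forall s, 0 <= s -> `|s - s'| < r -> forall y z, `|y| <= R0 -> `|z| <= Z ->
  forall v h, U v -> (forall v', U v' -> dotp (F s y v') z <= h) ->
  dotp (F (Num.max s' 0) y v) z <= h + e.

(** A failure is witnessed by fixed [s], [y], [z], [v], [h] and a strict inequality. With the
    control frozen, that inequality is continuous in [s'] and persists nearby. This is what makes
    the good times measurable. *)
Lemma open_not_good_time R0 Z e r : open [set s' | ~ good_time R0 Z e r s'].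
Proof.
rewrite openE => s' /= /existsNP[s] /not_implyP[s0] /not_implyP[ss] /existsNP[y].
move=> /existsNP[z] /not_implyP[yR] /not_implyP[zZ] /existsNP[v] /existsNP[h].
move=> /not_implyP[Uv] /not_implyP[Hh] /negP; rewrite -ltNge => Fh.
rewrite /interior/=; near=> s1 => /(_ s s0) H.
have s1r : `|s - s1| < r.
  near: s1; have /cvgr_lt : `|s - x| @[x --> s'] --> `|s - s'|.
    by apply: cvg_norm; apply: cvgB; [exact: cvg_cst|exact: cvg_id].
  by apply.
have := H s1r y z yR zZ v h Uv Hh; apply/negP; rewrite -ltNge.
near: s1; have /cvgr_gt : dotp (F (Num.max x 0) y v) z @[x --> s'] --> dotp (F (Num.max s' 0) y v) z.
  by apply: dotp_continuous; [exact: F_cont|exact: cst_continuous].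
by apply.
Unshelve. all: by end_near. Qed.

Lemma good_time_le R0 Z e r r' s' : r' <= r -> good_time R0 Z e r s' -> good_time R0 Z e r' s'.
Proof. by move=> rr G s s0 ss; apply: G => //; exact: lt_le_trans rr. Qed.

(** This is lower semicontinuity of the Hamiltonian in time: a control almost optimal at [s'] keeps
    almost the same value at close times, and so bounds the Hamiltonian there from below.
    Compactness in [y] and [z] makes the scale uniform. *)
Lemma exists_good_time R0 Z e s' : 0 < e -> 0 <= s' ->
  exists n, good_time R0 Z e n.+1%:R^-1 s'.
Proof.
move=> e0 s'0.
have [[v1 Uv1]|U0] := pselect (exists v, U v); last first.
  by exists 0%N => s _ _ y z _ _ v h Uv; case: U0; exists v.
have ms' : Num.max s' 0 = s' by apply/max_idPl.
have /compact_near_coveringP/near_covering_withinP := compact_setX (@compact_normr_le R d R0) (@compact_normr_le R d Z).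
move=> /(_ nat \oo (fun n yz => forall s, 0 <= s -> `|s - s'| < n.+1%:R^-1 ->
   forall v h, U v -> (forall v', U v' -> dotp (F s yz.1 v') yz.2 <= h) ->
   dotp (F s' yz.1 v) yz.2 <= h + e)) [].
  move=> [y0 z0] _.
  (* Four such errors are spent: near optimality of [v0], the change of time, and the passage
     between [(y, z)] and [(y0, z0)] twice. *)
  have e6 : 0 < e / 6 by rewrite divr_gt0.
  have [v0 Uv0 opt] : exists2 v0, U v0 & forall v, U v ->
      dotp (F s' y0 v) z0 <= dotp (F s' y0 v0) z0 + e / 6.
    have hs : has_sup [set dotp (F s' y0 v) z0 | v in U].
      split; first by exists (dotp (F s' y0 v1) z0), v1.
      exists (L * enorm z0) => _ [v Uv <-]; apply: le_trans (ler_norm _) _.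
      by apply: le_trans (cauchy_schwarz _ _) _; rewrite ler_wpM2r ?enorm_ge0// F_bnd.
    have [_ [v0 Uv0 <-] hv0] := sup_adherent e6 hs.
    exists v0 => // v Uv; rewrite -lerBlDr; apply: le_trans (ltW hv0); rewrite lerD2r.
    by apply: ub_le_sup; [case: hs|exists v].
  pose dl (yz : X * X) := L * enorm (yz.2 - z0) + L * enorm (yz.1 - y0) * enorm z0.
  have cdl : dl yz @[yz --> (y0, z0)] --> (0 : R).
    have d0 : (yz.2 - z0) @[yz --> (y0, z0)] --> z0 - z0.
      by apply: cvgB; [exact: cvg_snd|exact: cvg_cst].
    have d1 : (yz.1 - y0) @[yz --> (y0, z0)] --> y0 - y0.
      by apply: cvgB; [exact: cvg_fst|exact: cvg_cst].
    have e0' := cvg_comp _ _ d0 (@enorm_continuous (z0 - z0)).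
    have e1' := cvg_comp _ _ d1 (@enorm_continuous (y0 - y0)).
    have c0 := cvgM (cvg_cst L) e0'.
    have c1 := cvgM (cvgM (cvg_cst L) e1') (cvg_cst (enorm z0)).
    have -> : (0 : R) = L * enorm (z0 - z0) + L * enorm (y0 - y0) * enorm z0.
      rewrite !subrr (_ : enorm 0 = 0) ?mulr0 ?mul0r ?addr0//.
      by rewrite -[0](scale0r (0 : X)) enormZ normr0 mul0r.
    by apply: cvgD; [exact: c0|exact: c1].
  have cs : dotp (F (Num.max s 0) y0 v0) z0 @[s --> s'] --> dotp (F s' y0 v0) z0.
    rewrite -{2}ms'; apply: (@dotp_continuous _ _ _ (fun s : R => F (Num.max s 0) y0 v0) (cst z0)); last exact: cst_continuous.
    exact: F_cont.
  have /nbhs_ballP[r /= r0 Hr] : \forall s \near s', `|dotp (F s' y0 v0) z0 - dotp (F (Num.max s 0) y0 v0) z0| <= e / 6.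
    by move/cvgrPdist_le : cs; apply.
  exists ([set yz | dl yz <= e / 6], [set n | n.+1%:R^-1 < r]) => /=.
    split; first by move/cvgr_le : cdl; apply.
    exact: (near_infty_natSinv_lt (PosNum r0)).
  move=> [[y z] n] /= [dlyz nr] _ s s0 ss v h Uv Hh.
  have h1 := dotpF_le y y0 z z0 s'0 Uv.
  have h2 := opt _ Uv.
  have := Hr s; rewrite /ball/= distrC (lt_trans ss nr) => /(_ isT); rewrite (max_idPl s0) => h3.
  have h4 := dotpF_le y y0 z z0 s0 Uv0; have h5 := Hh _ Uv0.
  rewrite /dl/= in dlyz.
  move: h1 h3 h4; rewrite !ler_norml => /andP[_ h1] /andP[_ h3] /andP[h4 _]; lra.
move=> n _ /(_ n (leqnn _)) H; exists n => s s0 ss y z yR zZ v h Uv Hh.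
by rewrite ms'; exact: (H (y, z) _ s s0 ss v h Uv Hh).
Unshelve. all: by end_near. Qed.

(** As the scale [1 / (n + 1)] shrinks, the bad times in []0, t]] decrease to the empty set, and the
    measure is continuous from above. *)
Lemma good_times (R0 Z e eta t : R) : 0 < e -> 0 < eta -> 0 <= t ->
  exists r, [/\ 0 < r, measurable ([set s | good_time R0 Z e r s] : set (measurableTypeR R)) &
    (mu (`]0%R, t]%classic `\` [set s | good_time R0 Z e r s]) <= eta%:E)%E].
Proof.
move=> e0 eta0 t0.
pose G n := [set s | good_time R0 Z e n.+1%:R^-1 s] : set (measurableTypeR R).
have mG n : measurable (G n).
  by rewrite -[G n]setCK; apply: measurableC; apply: open_measurable; exact: open_not_good_time.
pose B n := (`]0%R, t]%classic : set (measurableTypeR R)) `\` G n.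
have mB n : measurable (B n) by apply: measurableD => //; exact: measurable_itv.
have niB : nonincreasing_seq B.
  move=> i j ij; apply/subsetPset; apply: setDS => s; apply: good_time_le.
  by rewrite lef_pV2 ?posrE// ler_nat.
have capB : \bigcap_n B n = set0.
  apply/seteqP; split => // s sB; have := sB 0%N I; rewrite /B/= in_itv/= => -[/andP[s0 _] _].
  by have [n Gn] := exists_good_time R0 Z e0 (ltW s0); have [_] := sB n I; apply.
have B0 : (mu (B 0%N) < +oo)%E.
  apply: (@le_lt_trans _ _ (mu `]0%R, t]%classic)).
    by apply: le_measure; rewrite ?inE//; exact: subDsetl.
  by rewrite lebesgue_measure_itv/=; case: ifP => _; rewrite ?ltry.
have := nonincreasing_cvg_mu B0 mB _ niB; rewrite capB measure0 => /(_ measurable0) cB.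
have [n Bn] : exists n, (mu (B n) <= eta%:E)%E.
  apply: contrapT => /forallNP H.
  have : (eta%:E <= 0)%E.
    apply: (cvge_to_ge cB); near=> n; rewrite ltW// ltNge; apply/negP; exact: H.
  by rewrite lee_fin leNgt eta0.
by exists n.+1%:R^-1; split; [rewrite invr_gt0|exact: mG|exact: Bn].
Unshelve. all: by end_near. Qed.

End GoodTimes.

(** * Points of a fixed mode *)

Section StateSpace.
Context (R : realType) (d dq : nat).
Local Notation X := 'rV[R]_d.
Local Notation Q := (mode dq).

Definition at_mode (q : Q) (y : X * R * R) : state R d dq := (y.1.1, q, y.1.2, y.2).

(** The modes are discrete, so small neighbourhoods contain a single mode, and local extremality
    need only be checked there. *)
Lemma near_at_mode (q : Q) (y : X * R * R) (P : state R d dq -> Prop) :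
  (\forall y' \near y, P (at_mode q y')) -> \forall z \near at_mode q y, P z.
Proof.
case: y => [[x p] s] [[A B] /= [[[C E] /= [nC nE] CE] nB] AB].
exists ([set z | (C z.1.1 /\ z.1.2 = q) /\ E z.2], B) => /=.
  split=> //; exists ([set z | C z.1 /\ z.2 = q], E) => //=; split=> //.
  by exists (C, [set q]) => /=; [split=> //; exact: discrete_set1|move=> [? ?] /= [? ->]].
move=> [[[x' q'] p'] s'] /= [[[Cx ->] Ep] Bs].
by apply: (AB ((x', p'), s')); split=> //=; apply: (CE (x', p')).
Qed.

Lemma at_mode_continuous (q : Q) : continuous (at_mode q).
Proof.
case=> [[x p] s] P [[A B] /= [[[C E] /= [nC nE] CE] nB] AB].
case: nC => -[G H] /= [nG nH] GH.
exists ([set z | G z.1 /\ E z.2], B) => /=.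
  by split=> //; exists (G, E).
move=> [[x' p'] s'] /= [[Gx Ep] Bs]; apply: (AB (((x', q), p'), s')); split=> //=.
apply: (CE ((x', q), p')); split=> //=; apply: (GH (x', q)); split=> //=.
exact: nbhs_singleton nH.
Qed.

End StateSpace.

(** * Viscosity inequalities in terms of controls *)

Section QuadraticContact.
Context (R : realType) (d m dq : nat) (delta t : R).
Context (U : mode dq -> set 'rV[R]_m) (W : mode dq -> set (mode dq)).
Context (f : R -> 'rV[R]_d -> 'rV[R]_m -> mode dq -> 'rV[R]_d).
Context (g : mode dq -> mode dq -> mode dq) (phi varphi : 'rV[R]_d -> R).
Local Notation X := 'rV[R]_d.
Implicit Types (u : state R d dq -> R) (q : mode dq).

Section Derivatives.
Variables (A P B A' P' B' : R -> R) (c : R) (a : X).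
Hypotheses (dA : forall x, is_derive x (1 : R) A (A' x)) (cA : continuous A').
Hypotheses (dP : forall x, is_derive x (1 : R) P (P' x)) (cP : continuous P').
Hypotheses (dB : forall x, is_derive x (1 : R) B (B' x)) (cB : continuous B').

Definition quad_state (z : state R d dq) : R := quad A P B c a (z.1.1.1, z.1.2, z.2).

Lemma test_fun_quad_state : test_fun quad_state.
Proof.
move=> q; rewrite (_ : (fun _ => _) = quad A P B c a); first exact: C1_quad dA cA dP cP dB cB.
by apply/funext => -[[]].
Qed.

Lemma grad_quad_state x q p s :
  grad_x quad_state x q p s = (2 * A s) *: (x - a) + (2 * c) *: x.
Proof. by apply/rowP => i; rewrite !mxE quad_grad !mxE. Qed.

Variables (u : state R d dq -> R) (x : X) (q : mode dq) (p s : R).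
Hypothesis xps : Obar t (x, q, p, s).

Let drift : R := A' s * dotp (x - a) (x - a) + B' s + P' p.
Let slope : X := (2 * A s) *: (x - a) + (2 * c) *: x.

(** The supremum in [Ham] bounds the value of every control, while [varphi x < u] excludes the
    obstacle alternative. *)
Lemma sub_quad : subsolution delta t U W f g phi varphi u ->
  (\forall y \near (x, p, s), Obar t (at_mode q y) ->
     u (at_mode q y) - quad A P B c a y <= u (x, q, p, s) - quad A P B c a (x, p, s)) ->
  [/\ 0 < p -> 0 < s -> varphi x < u (x, q, p, s) ->
        forall v, U q v -> drift + dotp (f s x v q) slope <= 0,
      p = 0 -> ((u (x, q, p, s))%:E <= Mplus delta t W g u x q s)%E &
      s = 0 -> u (x, q, p, s) <= Num.max (phi x) (varphi x)].
Proof.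
move=> us near_max.
have lm : loc_max t (fun z => u z - quad_state z) (x, q, p, s).
  rewrite /loc_max /within/=; apply: (@near_at_mode _ _ _ q (x, p, s)).
  apply: filterS near_max => y H Dy; rewrite /quad_state/=.
  by have := H Dy; case: y {H Dy} => [[]].
have [h1 h2 h3] := us _ test_fun_quad_state x q p s xps lm; split=> //.
move=> p0 s0 ux v Uv; move: xps; rewrite /Obar/= => -[/andP[_ pt] /andP[_ st]].
have := h1 (conj (introT andP (conj p0 pt)) (introT andP (conj s0 st))).
rewrite ge_min => /orP[|]; last by rewrite lee_fin subr_le0 leNgt ux.
rewrite grad_quad_state /dpsi_s /dpsi_p /quad_state/= (@quad_ds _ _ _ _ _ _ _ _ _ _ _ _ dA dB) (@quad_dp _ _ _ _ _ _ _ _ _ _ _ dP).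
move=> H; rewrite -lee_fin; apply: le_trans H; rewrite EFinD; apply: leeD2l.
by apply: ereal_sup_ubound; exists v.
Qed.

(** The supremum need not be attained, hence the slack [e]. As it is [-oo] over no control, the
    inequality also yields an element of [U q]. *)
Lemma super_quad : supersolution delta t U W f g phi varphi u ->
  (\forall y \near (x, p, s), Obar t (at_mode q y) ->
     u (x, q, p, s) - quad A P B c a (x, p, s) <= u (at_mode q y) - quad A P B c a y) ->
  [/\ 0 < p -> 0 < s -> varphi x <= u (x, q, p, s) /\
        forall e, 0 < e -> exists2 v, U q v & - e < drift + dotp (f s x v q) slope,
      p = 0 -> (Mminus delta t W g u x q s <= (u (x, q, p, s))%:E)%E &
      s = 0 -> Num.max (phi x) (varphi x) <= u (x, q, p, s)].
Proof.
move=> us near_min.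
have lm : loc_min t (fun z => u z - quad_state z) (x, q, p, s).
  rewrite /loc_min /within/=; apply: (@near_at_mode _ _ _ q (x, p, s)).
  apply: filterS near_min => y H Dy; rewrite /quad_state/=.
  by have := H Dy; case: y {H Dy} => [[]].
have [h1 h2 h3] := us _ test_fun_quad_state x q p s xps lm; split=> //.
move=> p0 s0; move: xps; rewrite /Obar/= => -[/andP[_ pt] /andP[_ st]].
have := h1 (conj (introT andP (conj p0 pt)) (introT andP (conj s0 st))).
rewrite le_min => /andP[]; rewrite lee_fin subr_ge0 => H ux; split=> // e e0.
move: H; rewrite grad_quad_state /dpsi_s /dpsi_p /quad_state/= (@quad_ds _ _ _ _ _ _ _ _ _ _ _ _ dA dB) (@quad_dp _ _ _ _ _ _ _ _ _ _ _ dP).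
rewrite -/drift -/slope => H.
have : ((- e - drift)%:E < Ham U f s x q slope)%E.
  apply: lt_le_trans (_ : ((- drift)%:E <= _)%E); first by rewrite lte_fin; lra.
  by rewrite EFinN -[X in (X <= _)%E]sub0e leeBlDl.
move=> /ereal_sup_gt[_ [v Uv <-]]; rewrite lte_fin => h; exists v => //; lra.
Qed.

End Derivatives.

End QuadraticContact.

(** * Existence of penalized minimizers near a given point *)

Section PenalizedMinimum.
Context (R : realType) (d : nat) (t : R).
Local Notation X := 'rV[R]_d.

Definition slab : set (X * R * R) := [set y | 0 <= y.1.2 <= t /\ 0 <= y.2 <= t].

Definition pen (N r0 C r : R) : R := N * (r - r0) ^+ 2 + C * r.

Lemma is_derive_pen (N r0 C r : R) :
  is_derive r (1 : R) (pen N r0 C) (2 * N * (r - r0) + C).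
Proof.
rewrite /pen; apply: is_derive_eq; rewrite /GRing.scale/=; ring.
Qed.

Lemma continuous_pen' (N r0 C : R) : continuous (fun r => 2 * N * (r - r0) + C).
Proof.
move=> r; apply: cvgD; last exact: cvg_cst.
by apply: cvgM; [exact: cvg_cst|apply: cvgB; [exact: cvg_id|exact: cvg_cst]].
Qed.

Lemma continuous_quad (A P B : R -> R) (c : R) (a : X) :
  continuous A -> continuous P -> continuous B -> continuous (quad A P B c a).
Proof.
move=> cA cP cB y.
have c2 : (fun y : X * R * R => y.2) y @[y --> y] --> y.2 by exact: cvg_snd.
have c1 : (fun y : X * R * R => y.1) y @[y --> y] --> y.1 by exact: cvg_fst.
have c12 : y.1.2 @[y --> y] --> y.1.2.
  by apply: (cvg_comp _ _ c1); exact: cvg_snd.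
have c11 : y.1.1 @[y --> y] --> y.1.1.
  by apply: (cvg_comp _ _ c1); exact: cvg_fst.
have ca : (y.1.1 - a) @[y --> y] --> (y.1.1 - a) by apply: cvgB; [exact: c11|exact: cvg_cst].
have da : dotp (y.1.1 - a) (y.1.1 - a) @[y --> y] --> dotp (y.1.1 - a) (y.1.1 - a).
  by apply: (@dotp_continuous _ _ _ (fun y : X * R * R => y.1.1 - a)); exact: ca.
have d0 : dotp y.1.1 y.1.1 @[y --> y] --> dotp y.1.1 y.1.1.
  by apply: (@dotp_continuous _ _ _ (fun y : X * R * R => y.1.1)); exact: c11.
apply: cvgD; last by apply: (cvg_comp _ _ c2); exact: cB.
apply: cvgD; last by apply: (cvg_comp _ _ c12); exact: cP.
apply: cvgD; last by apply: cvgM; [exact: cvg_cst|exact: d0].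
by apply: cvgM; [apply: (cvg_comp _ _ c2); exact: cA|exact: da].
Qed.

Lemma compact_slab_ball (r : R) : compact [set y | slab y /\ `|y.1.1| <= r].
Proof.
have := compact_setX (compact_setX (@compact_normr_le R d r) (@segment_compact R 0 t)) (@segment_compact R 0 t).
congr compact; apply/seteqP; split=> -[[x p] s]; rewrite /slab/= !in_itv/=.
  by move=> [[? ?] ?].
by move=> [[? ?] ?].
Qed.

(** The conditions [Cp * p0 = 0] and [Cs * s0 = 0] make the penalty vanish at the base point, so
    linear terms act only when that point lies on the corresponding face. As [w] oscillates by at
    most [2 * M], far points lose to the base point; this gives compactness and the final bounds. *)
Lemma penalized_min (w : X * R * R -> R) (M N Cp Cs : R) (x0 : X) (p0 s0 : R) :
  lsc_in slab w -> (forall y, slab y -> `|w y| <= M) -> slab (x0, p0, s0) ->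
  0 < N -> 0 <= Cp -> 0 <= Cs -> Cp * p0 = 0 -> Cs * s0 = 0 ->
  let Q := quad (cst N) (pen N p0 Cp) (pen N s0 Cs) 0 x0 in
  exists x p s, [/\ slab (x, p, s),
    forall y, slab y -> w (x, p, s) + Q (x, p, s) <= w y + Q y,
    w (x, p, s) <= w (x0, p0, s0) &
    [/\ N * dotp (x - x0) (x - x0) <= 2 * M, N * (p - p0) ^+ 2 <= 2 * M & N * (s - s0) ^+ 2 <= 2 * M]].
Proof.
move=> lw wM z0 N0 Cp0 Cs0 Cpp Css Q.
have Q0 : Q (x0, p0, s0) = 0.
  rewrite /Q /quad /pen/= !subrr expr0n/= Cpp Css.
  by rewrite [dotp 0 0]big1 => [|i _]; rewrite ?mxE; ring.
have QE x p s : Q (x, p, s) = N * dotp (x - x0) (x - x0) + (N * (p - p0) ^+ 2 + Cp * p) + (N * (s - s0) ^+ 2 + Cs * s).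
  by rewrite /Q /quad /pen/=; ring.
have M0 : 0 <= M by apply: le_trans (wM _ z0).
have w0M : w (x0, p0, s0) <= M by apply: le_trans (ler_norm _) (wM _ z0).
have Qlb x p s : slab (x, p, s) ->
    [/\ 0 <= N * dotp (x - x0) (x - x0), 0 <= N * (p - p0) ^+ 2, 0 <= N * (s - s0) ^+ 2, 0 <= Cp * p & 0 <= Cs * s].
  move=> [/= /andP[pp _] /andP[ss _]]; split; apply: mulr_ge0 => //; try exact: ltW; try exact: sqr_ge0.
  exact: dotp_ge0.
(* The [+ 1] gives [r <= r ^+ 2], hence [2 * M <= N * r ^+ 2]. *)
pose r := 2 * M / N + 1.
have r1 : 1 <= r by rewrite lerDr divr_ge0// ?mulr_ge0// ltW.
have Nr : 2 * M <= N * r ^+ 2.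
  have -> : 2 * M = N * (2 * M / N) by rewrite mulrCA divff ?mulr1// gt_eqF.
  apply: ler_wpM2l; first exact: ltW.
  by apply: (@le_trans _ _ r); [rewrite /r lerDl|rewrite expr2 ler_peMr// (le_trans _ r1)].
pose K := [set y | slab y /\ `|y.1.1| <= `|x0| + r].
have Kz0 : K (x0, p0, s0) by split=> //=; rewrite lerDl (le_trans _ r1).
have lK : lsc_in K (fun y => w y + Q y).
  apply: (@lsc_in_le _ _ slab); first by move=> y [].
  apply: lsc_inD => //; apply: continuous_lsc_in; apply: continuous_quad.
  - exact: cst_continuous.
  - by move=> u; apply: differentiable_continuous; apply/derivable1_diffP; case: (is_derive_pen N p0 Cp u).
  - by move=> u; apply: differentiable_continuous; apply/derivable1_diffP; case: (is_derive_pen N s0 Cs u).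
have [|[[x p] s] [sy xr] ymin] := lsc_in_compact_min (C := - M) (@compact_slab_ball _) (ex_intro _ _ Kz0) lK.
  move=> [[x p] s] [sy _]; rewrite QE; have [? ? ? ? ?] := Qlb _ _ _ sy.
  have := wM _ sy; rewrite ler_norml => /andP[? _]; lra.
have glob y : slab y -> w (x, p, s) + Q (x, p, s) <= w y + Q y.
  case: y => [[x' p'] s'] sy'; have [xr'|xr'] := leP `|x'| (`|x0| + r).
    exact: ymin.
  apply: le_trans (ymin _ Kz0) _; rewrite Q0 QE; have [h1 h2 h3 h4 h5] := Qlb _ _ _ sy'.
  have nx : r <= `|x' - x0|.
    have := ler_normD (x' - x0) x0; rewrite subrK; lra.
  have : N * r ^+ 2 <= N * dotp (x' - x0) (x' - x0).
    apply: ler_wpM2l; first exact: ltW.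
    apply: le_trans (norm_sqr_le_dotp _); rewrite ler_sqr// nnegrE// (le_trans _ r1)//.
  have := wM _ sy'; rewrite ler_norml => /andP[? _]; lra.
have := glob _ z0; rewrite Q0 QE addr0; have [? ? ? ? ?] := Qlb _ _ _ sy.
have := wM _ sy; rewrite ler_norml => /andP[? _] ?.
exists x, p, s; split=> //; last split; lra.
Qed.

Lemma lsc_at_mode dq (q : mode dq) (u : state R d dq -> R) :
  lsc_Obar t u -> lsc_in slab (fun y => u (at_mode q y)).
Proof.
move=> lu y Dy c cu; have [V] := lu (at_mode q y) c cu.
rewrite /nbhs/= -nbhs_subspace_in// => nV Vc.
have nV' : nbhs (at_mode q y) (fun z => Obar t z -> V z) by exact: nV.
have nV2 : \forall y' \near y, Obar t (at_mode q y') -> V (at_mode q y').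
  exact: (at_mode_continuous nV').
apply: filterS nV2 => y' H Dy'.
by have := Vc _ (H Dy'); rewrite lte_fin.
Qed.

End PenalizedMinimum.

(** * Contacts at the boundary under a steep penalty *)

Section BoundaryContact.
Context (R : realType) (d m dq : nat) (delta t : R).
Context (U : mode dq -> set 'rV[R]_m) (W : mode dq -> set (mode dq)).
Context (f : R -> 'rV[R]_d -> 'rV[R]_m -> mode dq -> 'rV[R]_d).
Context (g : mode dq -> mode dq -> mode dq) (phi varphi : 'rV[R]_d -> R).
Local Notation X := 'rV[R]_d.
Variable Lf : R.
Hypothesis Lf_ge0 : 0 <= Lf.
Hypothesis f_bnd : forall s y q v, 0 <= s -> U q v -> enorm (f s y v q) <= Lf.
Implicit Types (u : state R d dq -> R) (q : mode dq).

Lemma sqr_le_abs (N e a M : R) : 0 < N -> 0 <= e -> 2 * M <= N * e ^+ 2 -> N * a ^+ 2 <= 2 * M -> `|a| <= e.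
Proof.
move=> N0 e0 h1 h2; rewrite -ler_sqr ?nnegrE// real_normK ?num_real//.
by rewrite -(ler_pM2l N0) (le_trans h2).
Qed.

Lemma exists_penalty (M e : R) : 0 < e -> exists2 N, 0 < N & 2 * M <= N * e ^+ 2.
Proof.
move=> e0; exists (2 * `|M| / e ^+ 2 + 1); first by rewrite ltr_wpDl// divr_ge0// ?sqr_ge0// mulr_ge0.
rewrite [X in _ <= X]mulrDl divfK ?gt_eqF ?exprn_gt0// mul1r; have := ler_norm M; have := sqr_ge0 e; lra.
Qed.

Lemma dotp_slope_le q s x x0 v (k N e : R) : 0 <= s -> U q v -> 0 < N -> 0 <= e ->
  enorm (x - x0) <= e ->
  `|dotp (f s x v q) ((2 * N) *: (x - x0) + (2 * 0) *: x)| <= 2 * N * e * Lf.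
Proof.
move=> s0 Uv N0 e0 xe; rewrite mulr0 scale0r addr0 dotpZr normrM ger0_norm; last lra.
rewrite -!mulrA; apply: ler_wpM2l => //; apply: ler_wpM2l; first exact: ltW.
rewrite mulrC; apply: le_trans (cauchy_schwarz _ _) _.
by apply: ler_pM => //; rewrite ?enorm_ge0// f_bnd.
Qed.

(** A slope [C] large enough in a variable that vanishes at the base point makes the interior
    inequality false, which leaves the obstacle or a boundary condition. A control is needed to
    bound the Hamiltonian from below. *)
Lemma contact_sub u q x0 p0 s0 e :
  BUSC t u -> subsolution delta t U W f g phi varphi u ->
  (exists v, U q v) -> slab t (x0, p0, s0) -> p0 = 0 \/ s0 = 0 -> 0 < e ->
  exists x p s, [/\ slab t (x, p, s), [/\ enorm (x - x0) <= e, `|p - p0| <= e & `|s - s0| <= e],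
    u (x0, q, p0, s0) <= u (x, q, p, s) &
    [\/ u (x, q, p, s) <= varphi x,
        p = 0 /\ ((u (x, q, p, s))%:E <= Mplus delta t W g u x q s)%E |
        s = 0 /\ u (x, q, p, s) <= Num.max (phi x) (varphi x)]].
Proof.
move=> [[M uM] usc_u] us [v Uv] z0 bd e0.
have [N N0 NM] := exists_penalty M e0.
(* Within distance [e] of the base point the quadratic terms contribute at most [2 * N * e] for each
   of [p] and [s], and [2 * N * e * Lf] through the dynamics; [C] exceeds the total by 1. *)
pose C := 4 * N * e + 2 * N * e * Lf + 1.
have C0 : 0 <= C by rewrite /C; have Ne0 := mulr_ge0 (ltW N0) (ltW e0); have := mulr_ge0 Ne0 Lf_ge0; lra.
pose Cp := if p0 == 0 then C else 0; pose Cs := if s0 == 0 then C else 0.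
have Cp0 : 0 <= Cp by rewrite /Cp; case: ifP.
have Cs0 : 0 <= Cs by rewrite /Cs; case: ifP.
have Cpp : Cp * p0 = 0 by rewrite /Cp; case: eqP => [->|]; rewrite ?mulr0 ?mul0r.
have Css : Cs * s0 = 0 by rewrite /Cs; case: eqP => [->|]; rewrite ?mulr0 ?mul0r.
have CC : C <= Cp + Cs.
  by rewrite /Cp /Cs; case: bd => ->; rewrite eqxx ?lerDl ?lerDr; case: ifP.
have wM y : slab t y -> `|- u (at_mode q y)| <= M by move=> sy; rewrite normrN uM.
have [x [p [s [sy ymin uu [dx dp ds]]]]] :=
  penalized_min (lsc_at_mode (q:=q) usc_u) wM z0 N0 Cp0 Cs0 Cpp Css.
have ex : enorm (x - x0) <= e.
  by have := @sqr_le_abs N e (enorm (x - x0)) M N0 (ltW e0) NM; rewrite enorm_sqr ger0_norm ?enorm_ge0//; apply.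
have ep := sqr_le_abs N0 (ltW e0) NM dp; have es := sqr_le_abs N0 (ltW e0) NM ds.
exists x, p, s; split=> //; first by move: uu; rewrite /at_mode/=; lra.
have dc r : is_derive r (1 : R) (cst N) (cst 0 r) by exact: is_derive_cst.
have cc : continuous (cst 0 : R -> R) by exact: cst_continuous.
have xps : Obar t (x, q, p, s) by [].
have [|h1 h2 h3] := sub_quad (a := x0) (c := 0) dc cc (is_derive_pen N p0 Cp) (@continuous_pen' _ N p0 Cp)
  (is_derive_pen N s0 Cs) (@continuous_pen' _ N s0 Cs) xps us.
  by apply: (@nearW _ (nbhs (x, p, s))) => y Dy; have := ymin y Dy; rewrite /at_mode/=; lra.
move: (sy) => [/= /andP[+ _] /andP[+ _]].
rewrite le_eqVlt => /predU1P[p0'|p_gt0]; first by move=> _; constructor 2; split; [|apply: h2].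
rewrite le_eqVlt => /predU1P[s0'|s_gt0]; first by constructor 3; split; [|apply: h3].
have [|vu] := leP (u (x, q, p, s)) (varphi x); first by constructor 1.
have := h1 p_gt0 s_gt0 vu v Uv; have := @dotp_slope_le q s x x0 v 0 N e (ltW s_gt0) Uv N0 (ltW e0) ex.
rewrite /cst mul0r add0r ler_norml => /andP[d1 _] d2.
exfalso; move: ep es; rewrite !ler_norml => /andP[p1 _] /andP[s1 _].
have := ler_wpM2l (ltW N0) p1; have := ler_wpM2l (ltW N0) s1; move: CC d1 d2; rewrite /C; lra.
Qed.

(** The penalty is reversed. At a base point with [p0] and [s0] nonzero there is no linear term, and
    an interior contact is then informative: it gives the obstacle inequality and a control. *)
Lemma contact_super u q x0 p0 s0 e :
  BLSC t u -> supersolution delta t U W f g phi varphi u ->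
  slab t (x0, p0, s0) -> 0 < e ->
  exists x p s, [/\ slab t (x, p, s), [/\ enorm (x - x0) <= e, `|p - p0| <= e & `|s - s0| <= e],
    u (x, q, p, s) <= u (x0, q, p0, s0) &
    [\/ [/\ p0 <> 0, s0 <> 0, varphi x <= u (x, q, p, s) & exists v, U q v],
        p = 0 /\ (Mminus delta t W g u x q s <= (u (x, q, p, s))%:E)%E |
        s = 0 /\ Num.max (phi x) (varphi x) <= u (x, q, p, s)]].
Proof.
move=> [[M uM] lsc_u] us z0 e0.
have [N N0 NM] := exists_penalty M e0.
pose C := 4 * N * e + 2 * N * e * Lf + 1.
have C0 : 0 <= C by rewrite /C; have Ne0 := mulr_ge0 (ltW N0) (ltW e0); have := mulr_ge0 Ne0 Lf_ge0; lra.
pose Cp := if p0 == 0 then C else 0; pose Cs := if s0 == 0 then C else 0.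
have Cp0 : 0 <= Cp by rewrite /Cp; case: ifP.
have Cs0 : 0 <= Cs by rewrite /Cs; case: ifP.
have Cpp : Cp * p0 = 0 by rewrite /Cp; case: eqP => [->|]; rewrite ?mulr0 ?mul0r.
have Css : Cs * s0 = 0 by rewrite /Cs; case: eqP => [->|]; rewrite ?mulr0 ?mul0r.
have CC : p0 = 0 \/ s0 = 0 -> C <= Cp + Cs.
  by rewrite /Cp /Cs; case=> ->; rewrite eqxx ?lerDl ?lerDr; case: ifP.
have wM y : slab t y -> `|u (at_mode q y)| <= M by move=> sy; rewrite uM.
have [x [p [s [sy ymin uu [dx dp ds]]]]] :=
  penalized_min (lsc_at_mode (q:=q) lsc_u) wM z0 N0 Cp0 Cs0 Cpp Css.
have ex : enorm (x - x0) <= e.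
  by have := @sqr_le_abs N e (enorm (x - x0)) M N0 (ltW e0) NM; rewrite enorm_sqr ger0_norm ?enorm_ge0//; apply.
have ep := sqr_le_abs N0 (ltW e0) NM dp; have es := sqr_le_abs N0 (ltW e0) NM ds.
exists x, p, s; split=> //.
have dc r : is_derive r (1 : R) (cst (- N)) (cst 0 r) by exact: is_derive_cst.
have cc : continuous (cst 0 : R -> R) by exact: cst_continuous.
have xps : Obar t (x, q, p, s) by [].
have [|h1 h2 h3] := super_quad (a := x0) (c := 0) dc cc (is_derive_pen (- N) p0 (- Cp)) (@continuous_pen' _ (- N) p0 (- Cp))
  (is_derive_pen (- N) s0 (- Cs)) (@continuous_pen' _ (- N) s0 (- Cs)) xps us.
  apply: (@nearW _ (nbhs (x, p, s))) => y Dy; have := ymin y Dy; rewrite /at_mode/= /quad /pen/=; lra.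
move: (sy) => [/= /andP[+ _] /andP[+ _]].
rewrite le_eqVlt => /predU1P[p0'|p_gt0]; first by move=> _; constructor 2; split; [|apply: h2].
rewrite le_eqVlt => /predU1P[s0'|s_gt0]; first by constructor 3; split; [|apply: h3].
(* The slack 1 equals the excess built into [C]; the contradiction comes from the strict
   inequality. *)
have [vu /(_ 1 ltr01) [v Uv d2]] := h1 p_gt0 s_gt0; constructor 1.
suff nb : ~ (p0 = 0 \/ s0 = 0).
  by split=> //; [move=> p00; apply: nb; left|move=> s00; apply: nb; right|exists v].
move=> /CC {}CC; move: d2; have := @dotp_slope_le q s x x0 v 0 N e (ltW s_gt0) Uv N0 (ltW e0) ex.
rewrite /cst mul0r add0r mulrN scaleNr mulr0 !scale0r !addr0 ler_norml dotpZr.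
rewrite -scaleNr dotpZr => /andP[d1 _] d3.
move: ep es; rewrite !ler_norml => /andP[p1 _] /andP[s1 _].
have := ler_wpM2l (ltW N0) p1; have := ler_wpM2l (ltW N0) s1; move: CC d1 d3; rewrite /C; lra.
Qed.

End BoundaryContact.

(** * Pointwise boundary conditions *)

Section BoundaryConditions.
Context (R : realType) (d m dq : nat) (delta t : R).
Context (U : mode dq -> set 'rV[R]_m) (W : mode dq -> set (mode dq)).
Context (f : R -> 'rV[R]_d -> 'rV[R]_m -> mode dq -> 'rV[R]_d).
Context (g : mode dq -> mode dq -> mode dq) (phi varphi : 'rV[R]_d -> R).
Local Notation X := 'rV[R]_d.
Implicit Types (u : state R d dq -> R) (q : mode dq).

Lemma near_triple (x0 : X) (p0 s0 : R) (P : X * R * R -> Prop) :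
  (\forall y \near (x0, p0, s0), P y) ->
  exists2 e, 0 < e & forall x p s, enorm (x - x0) <= e -> `|p - p0| <= e -> `|s - s0| <= e -> P (x, p, s).
Proof.
move=> /nbhs_ballP[r /= r0 H]; exists (r / 2); first by rewrite divr_gt0.
move=> x p s hx hp hs; have r2 : r / 2 < r by lra.
apply: H; split; [split|] => /=.
- rewrite -ball_normE /ball_/= distrC; apply: le_lt_trans r2; apply: le_trans hx.
  by rewrite -ler_sqr ?nnegrE ?enorm_ge0// enorm_sqr norm_sqr_le_dotp.
- by rewrite /ball/= distrC; apply: le_lt_trans r2.
- by rewrite /ball/= distrC; apply: le_lt_trans r2.
Qed.

Lemma near_tripleP (x0 : X) (p0 s0 : R) (P : X * R * R -> Prop) :
  (\forall y \near (x0, p0, s0), P y) ->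
  exists A B C, [/\ nbhs x0 A, nbhs p0 B, nbhs s0 C &
    forall x p s, A x -> B p -> C s -> P (x, p, s)].
Proof.
move=> [[A B] /= [[[C E] /= [nC nE] CE] nB] AB].
exists C, E, B; split=> // x p s Cx Ep Bs.
by apply: (AB ((x, p), s)); split=> //=; apply: (CE (x, p)).
Qed.

Lemma near_ends (x0 : X) (p0 s0 : R) (A : set X) (C : set R) : nbhs x0 A -> nbhs s0 C ->
  \forall y \near (x0, p0, s0), A y.1.1 /\ C y.2.
Proof.
move=> nA nC; exists ([set z | A z.1], C) => /=.
  by split=> //; exists (A, setT) => //=; [split=> //; exact: filterT|move=> [? ?] /= []].
by move=> [[x p] s] /= [].
Qed.

Lemma lsc_env_ge u z (c : R) : lsc_Obar t u -> Obar t z -> c < u z -> (c%:E <= lsc_env t u z)%E.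
Proof.
move=> lu Dz cu; have [V + Vc] := lu z c cu.
rewrite /nbhs/= -nbhs_subspace_in// => nV.
rewrite /lsc_env limf_einfE; apply: le_trans (_ : (ereal_inf ((fun z' => (u z')%:E) @` V) <= _)%E).
  by apply: le_ereal_inf_tmp => _ [z' Vz' <-]; exact/ltW/Vc.
by apply: ereal_sup_ubound; exists V.
Qed.

Lemma usc_env_le u z (c : R) : usc_Obar t u -> Obar t z -> u z < c -> (usc_env t u z <= c%:E)%E.
Proof.
move=> lu Dz cu; have [|V + Vc] := lu z (- c); first by rewrite lte_fin; lra.
rewrite /nbhs/= -nbhs_subspace_in// => nV.
rewrite /usc_env limf_esupE; apply: le_trans (_ : (_ <= ereal_sup ((fun z' => (u z')%:E) @` V))%E) _.
  by apply: ereal_inf_lbound; exists V.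
apply: ge_ereal_sup => _ [z' Vz' <-]; rewrite lee_fin ltW//.
by have := Vc _ Vz'; rewrite lte_fin; lra.
Qed.

Hypothesis delta_gt0 : 0 < delta.

(** A single admissible switch bounds the infimum from above, so semicontinuity at one point is
    enough. *)
Lemma Mplus_le_near u q (w : mode dq) (p' c : R) (x0 : X) (p0 s0 : R) :
  usc_Obar t u -> W q w -> delta <= p' <= t -> 0 <= s0 <= t -> u (x0, g w q, p', s0) < c ->
  \forall y \near (x0, p0, s0), 0 <= y.2 <= t -> (Mplus delta t W g u y.1.1 q y.2 <= c%:E)%E.
Proof.
move=> lu Ww dp ds uc.
have pp : 0 <= p' <= t by move: dp => /andP[h1 ->]; rewrite (le_trans (ltW delta_gt0) h1).
have H : \forall y \near (x0, p', s0), slab t y -> - c < - u (at_mode (g w q) y).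
  by apply: (lsc_at_mode (u := fun z => - u z) lu) => //=; lra.
have [A [B [C [nA nB nC HABC]]]] := near_tripleP H.
apply: filterS (near_ends p0 nA nC) => y /= [Ay Cy] sy.
have {}H := HABC _ _ _ Ay (nbhs_singleton nB) Cy.
have uy : u (y.1.1, g w q, p', y.2) < c by have := H (conj pp sy); rewrite /at_mode/=; lra.
apply: le_trans (usc_env_le lu _ uy); last by split.
by apply: ereal_inf_lbound; exists (w, p').
Qed.

(** A lower bound must hold for all switches at once: there are finitely many [w], and [p'] ranges
    over the compact [[delta, t]], so a common neighbourhood exists. *)
Lemma Mminus_ge_near u q (c : R) (x0 : X) (p0 s0 : R) :
  lsc_Obar t u -> 0 <= s0 <= t ->
  (forall w p', W q w -> delta <= p' <= t -> c < u (x0, g w q, p', s0)) ->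
  \forall y \near (x0, p0, s0), 0 <= y.2 <= t -> (c%:E <= Mminus delta t W g u y.1.1 q y.2)%E.
Proof.
move=> lu ds uc.
pose S (w : 'I_dq.+1) (y : X * R * R) := forall p', `[delta, t]%classic p' ->
  W q w -> 0 <= y.2 <= t -> c < u (y.1.1, g w q, p', y.2).
suff H : \forall y \near (x0, p0, s0), forall w, S w y.
  apply: filterS H => y H sy; apply: le_ereal_inf_tmp => _ [[w p'] /= [Ww dp] <-].
  apply: lsc_env_ge => //; last by apply: H; rewrite //= in_itv.
  by split=> //=; move: dp => /andP[h1 ->]; rewrite (le_trans (ltW delta_gt0) h1).
apply: (@filter_forall _ _ S (nbhs (x0, p0, s0)) _) => w; rewrite /S.
have [Ww|nW] := pselect (W q w); last by near=> y => p' _ /nW.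
have /compact_near_coveringP/near_covering_withinP cov := @segment_compact R delta t.
pose T (y : X * R * R) (p' : R) := W q w -> 0 <= y.2 <= t -> c < u (y.1.1, g w q, p', y.2).
suff step : forall p', `[delta, t]%classic p' ->
    \forall p'' \near p' & y \near (x0, p0, s0), `[delta, t]%classic p'' -> T y p''.
  have H := cov _ (nbhs (x0, p0, s0)) T _ step.
  by apply: filterS (H _) => y Hy p' dp; exact: Hy.
move=> p' /=; rewrite in_itv/= => dp.
have pp : 0 <= p' <= t by move: dp => /andP[h1 ->]; rewrite (le_trans (ltW delta_gt0) h1).
have H : \forall y \near (x0, p', s0), slab t y -> c < u (at_mode (g w q) y).
  by apply: lsc_at_mode => //=; exact: uc.
have [A [B [C [nA nB nC HABC]]]] := near_tripleP H.
exists (B, [set y | A y.1.1 /\ C y.2]) => /=.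
  by split=> //; exact: near_ends.
move=> [p'' y] /= [Bp [Ay Cy]] dp'' _ sy.
apply: (HABC _ _ _ Ay Bp Cy); split=> //=; move: dp''; rewrite in_itv/= => /andP[h1 ->].
by rewrite (le_trans (ltW delta_gt0) h1).
Unshelve. all: by end_near. Qed.

Variable Lf : R.
Hypothesis Lf_ge0 : 0 <= Lf.
Hypothesis f_bnd : forall s y q v, 0 <= s -> U q v -> enorm (f s y v q) <= Lf.
Hypothesis t_gt0 : 0 < t.
Hypotheses (phi_cont : continuous phi) (varphi_cont : continuous varphi).

Local Notation bdry := (fun x => Num.max (phi x) (varphi x)).

Let bdry_cont : continuous bdry.
Proof. by move=> x; apply: (@continuous_max R X phi varphi); [exact: phi_cont|exact: varphi_cont]. Qed.

Lemma near_gt (h : X -> R) (x0 : X) (p0 s0 c : R) : continuous h -> c < h x0 ->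
  \forall y \near (x0, p0, s0), c < h y.1.1.
Proof.
move=> ch hc; have nA : nbhs x0 [set z | c < h z] by apply: (cvgr_gt (h x0) (ch x0)).
have nT : nbhs s0 [set: R] by exact: filterT.
by apply: filterS (near_ends p0 nA nT) => y /= [hy _].
Qed.

Lemma near_lt (h : X -> R) (x0 : X) (p0 s0 c : R) : continuous h -> h x0 < c ->
  \forall y \near (x0, p0, s0), h y.1.1 < c.
Proof.
move=> ch hc; have nA : nbhs x0 [set z | h z < c] by apply: (cvgr_lt (h x0) (ch x0)).
have nT : nbhs s0 [set: R] by exact: filterT.
by apply: filterS (near_ends p0 nA nT) => y /= [hy _].
Qed.

Section Super.
Variable u : state R d dq -> R.
Hypotheses (u_blsc : BLSC t u) (u_super : supersolution delta t U W f g phi varphi u).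

(** Contacts exist arbitrarily close to the point, with values of [u] no larger than there;
    continuity of [varphi] then gives the obstacle inequality at the point itself. *)
Lemma super_interior q x p s : 0 < p <= t -> 0 < s <= t ->
  varphi x <= u (x, q, p, s) /\ exists v, U q v.
Proof.
move=> /andP[p0 pt] /andP[s0 st].
have sl : slab t (x, p, s) by split; rewrite /= ltW.
have key e : 0 < e -> exists2 x', enorm (x' - x) <= e & varphi x' <= u (x, q, p, s) /\ exists v, U q v.
  (* Radii [p / 2] and [s / 2] keep the contact off the faces [p = 0] and [s = 0]. *)
  move=> e0; pose e' := Num.min e (Num.min (p / 2) (s / 2)).
  have e'0 : 0 < e' by rewrite !lt_min e0 !divr_gt0.
  have /andP[e1 /andP[e2 e3]] : (e' <= e) && ((e' <= p / 2) && (e' <= s / 2)).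
    by rewrite -!le_min.
  have [x' [p' [s' [_ [ex ep es] uu]]]] := contact_super Lf_ge0 f_bnd q u_blsc u_super sl e'0.
  case=> [[_ _ vu Uv]|[pp _]|[ss _]].
  - by exists x'; [exact: le_trans e1|split=> //; exact: le_trans uu].
  - by move: ep; rewrite pp sub0r normrN gtr0_norm//; lra.
  - by move: es; rewrite ss sub0r normrN gtr0_norm//; lra.
split; last by have [x' _ []] := key 1 ltr01.
rewrite leNgt; apply/negP => h.
have [e e0 H] := near_triple (near_gt p s varphi_cont h).
have [x' xe [vu _]] := key e e0.
have := H x' p s xe; rewrite !subrr normr0 => /(_ (ltW e0) (ltW e0))/=.
by rewrite ltNge vu.
Qed.

(** The infimum over no switch being [+oo], this also shows that [W q] is nonempty and that
    [delta <= t]. *)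
Lemma super_switch q x s : 0 < s <= t -> forall c, 0 < c -> exists w p',
  [/\ W q w, delta <= p' <= t & u (x, g w q, p', s) <= u (x, q, 0, s) + c].
Proof.
move=> /andP[s0 st] c c0; apply: contrapT => H.
have sl : slab t (x, 0, s) by split; rewrite /= ?lexx ltW.
have /(_ _ _) K : forall w p', W q w -> delta <= p' <= t -> u (x, q, 0, s) + c / 2 < u (x, g w q, p', s).
  move=> w p' Ww dp; rewrite ltNge; apply/negP => le; apply: H; exists w, p'; split=> //.
  by apply: le_trans le _; lra.
have [|e e0 He] := near_triple (Mminus_ge_near 0 u_blsc.2 _ K); first by rewrite st ltW.
pose e' := Num.min e (s / 2).
have e'0 : 0 < e' by rewrite lt_min e0 divr_gt0.
have /andP[e1 e2] : (e' <= e) && (e' <= s / 2) by rewrite -le_min.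
have [x' [p' [s' [[_ sl'] [ex ep es] uu]]]] := contact_super Lf_ge0 f_bnd q u_blsc u_super sl e'0.
case=> [[]//|[pp Mu]|[ss _]].
- have := He x' p' s' (le_trans ex e1) (le_trans ep e1) (le_trans es e1) sl'.
  by move=> /le_trans/(_ Mu); rewrite lee_fin/=; lra.
- by move: es; rewrite ss sub0r normrN gtr0_norm//; lra.
Qed.

Lemma super_initial q x p : 0 <= p <= t -> bdry x <= u (x, q, p, 0).
Proof.
have pos q' x' p0 : 0 < p0 <= t -> bdry x' <= u (x', q', p0, 0).
  move=> /andP[p0_gt pt]; rewrite leNgt; apply/negP => h.
  have sl : slab t (x', p0, 0) by split; rewrite /= ?lexx ltW.
  have [e e0 He] := near_triple (near_gt p0 0 bdry_cont h).
  pose e' := Num.min e (p0 / 2).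
  have e'0 : 0 < e' by rewrite lt_min e0 divr_gt0.
  have /andP[e1 e2] : (e' <= e) && (e' <= p0 / 2) by rewrite -le_min.
  have [y [p' [s' [_ [ex ep es] uu]]]] := contact_super Lf_ge0 f_bnd q' u_blsc u_super sl e'0.
  case=> [[]//|[pp _]|[ss Mu]].
  - by move: ep; rewrite pp sub0r normrN gtr0_norm//; lra.
  - have := He y p' s' (le_trans ex e1) (le_trans ep e1) (le_trans es e1).
    by move=> /= /lt_le_trans/(_ Mu)/lt_le_trans/(_ uu); rewrite ltxx.
move=> /andP[]; rewrite le_eqVlt => /predU1P[<-{p} _|p0 pt]; last by apply: pos; rewrite p0.
rewrite leNgt; apply/negP => h.
have sl : slab t (x, 0, 0) by split; rewrite /= ?lexx ltW.
(* At the corner the contact may satisfy only the switch condition. Switched points have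
   [p' >= delta > 0], so [pos] bounds them from below, and [c] leaves room for semicontinuity. *)
pose c := (bdry x + u (x, q, 0, 0)) / 2.
have [c1 c2] : u (x, q, 0, 0) < c /\ c < bdry x by rewrite /c; split; lra.
have [e e0 He] := near_triple (near_gt 0 0 bdry_cont h).
have [||e2 e20 He2] := near_triple (@Mminus_ge_near u q c x 0 0 u_blsc.2 _ _).
- by rewrite lexx ltW.
- move=> w p' Ww /andP[dp pt]; apply: lt_le_trans c2 (pos _ _ _ _).
  by rewrite pt (lt_le_trans delta_gt0).
pose e' := Num.min e e2.
have e'0 : 0 < e' by rewrite lt_min e0.
have /andP[ee1 ee2] : (e' <= e) && (e' <= e2) by rewrite -le_min.
have [y [p' [s' [[_ sl'] [ex ep es] uu]]]] := contact_super Lf_ge0 f_bnd q u_blsc u_super sl e'0.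
case=> [[]//|[pp Mu]|[ss Mu]].
- have := He2 y p' s' (le_trans ex ee2) (le_trans ep ee2) (le_trans es ee2) sl'.
  by move=> /le_trans/(_ Mu); rewrite lee_fin/=; lra.
- have := He y p' s' (le_trans ex ee1) (le_trans ep ee1) (le_trans es ee1).
  by move=> /= /lt_le_trans/(_ Mu)/lt_le_trans/(_ uu); rewrite ltxx.
Qed.

End Super.

Section Sub.
Variable u : state R d dq -> R.
Hypotheses (u_busc : BUSC t u) (u_sub : subsolution delta t U W f g phi varphi u).
Hypothesis U_neq0 : forall q, exists v, U q v.

(** The term [varphi x] is there because the penalized contact may leave [p = 0] and rest on the
    obstacle. *)
Lemma sub_switch q x s : 0 < s <= t -> forall w p', W q w -> delta <= p' <= t ->
  u (x, q, 0, s) <= Num.max (varphi x) (u (x, g w q, p', s)).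
Proof.
move=> /andP[s0 st] w p' Ww dp; rewrite leNgt; apply/negP; rewrite gt_max => /andP[h1 h2].
have sl : slab t (x, 0, s) by split; rewrite /= ?lexx ltW.
pose a := Num.max (varphi x) (u (x, g w q, p', s)).
pose c := (a + u (x, q, 0, s)) / 2.
have au : a < u (x, q, 0, s) by rewrite gt_max h1.
have [c1 c2] : a < c /\ c < u (x, q, 0, s) by rewrite /c; split; lra.
have [c3 c4] : varphi x < c /\ u (x, g w q, p', s) < c.
  by split; apply: le_lt_trans c1; rewrite le_max lexx ?orbT.
have [e e0 He] := near_triple (near_lt 0 s varphi_cont c3).
have [|e2 e20 He2] := near_triple (Mplus_le_near 0 u_busc.2 Ww dp _ c4); first by rewrite st ltW.
pose e' := Num.min (Num.min e e2) (s / 2).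
have e'0 : 0 < e' by rewrite !lt_min e0 e20 divr_gt0.
have /andP[/andP[ee1 ee2] ee3] : ((e' <= e) && (e' <= e2)) && (e' <= s / 2) by rewrite -!le_min.
have [y [r [s' [[_ sl'] [ex ep es] uu]]]] :=
  contact_sub Lf_ge0 f_bnd u_busc u_sub (U_neq0 q) sl (or_introl erefl) e'0.
case=> [uv|[_ Mu]|[ss _]].
- have := He y r s' (le_trans ex ee1) (le_trans ep ee1) (le_trans es ee1); rewrite /=; lra.
- have := He2 y r s' (le_trans ex ee2) (le_trans ep ee2) (le_trans es ee2) sl'.
  by move=> /(le_trans Mu); rewrite lee_fin/=; lra.
- by move: es; rewrite ss sub0r normrN gtr0_norm//; lra.
Qed.

(** The obstacle alternative is harmless since [varphi] is below the initial datum. The admissible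
    switch is used at the corner only, to reach some [p' >= delta]. *)
Lemma sub_initial q x p : 0 <= p <= t ->
  (exists w p', W q w /\ delta <= p' <= t) -> u (x, q, p, 0) <= bdry x.
Proof.
move=> pt0 [w [pw [Ww dp]]].
have vb y : varphi y <= bdry y by rewrite le_max lexx orbT.
have pos q' x' p0 : 0 < p0 <= t -> u (x', q', p0, 0) <= bdry x'.
  move=> /andP[p0_gt pt]; rewrite leNgt; apply/negP => h.
  have sl : slab t (x', p0, 0) by split; rewrite /= ?lexx ltW.
  have [e e0 He] := near_triple (near_lt p0 0 bdry_cont h).
  pose e' := Num.min e (p0 / 2).
  have e'0 : 0 < e' by rewrite lt_min e0 divr_gt0.
  have /andP[e1 e2] : (e' <= e) && (e' <= p0 / 2) by rewrite -le_min.
  have [y [p' [s' [_ [ex ep es] uu]]]] :=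
    contact_sub Lf_ge0 f_bnd u_busc u_sub (U_neq0 q') sl (or_intror erefl) e'0.
  have /= hb := He y p' s' (le_trans ex e1) (le_trans ep e1) (le_trans es e1); have vy := vb y.
  case=> [uv|[pp _]|[ss Mu]]; [lra| |lra].
  by move: ep; rewrite pp sub0r normrN gtr0_norm//; lra.
move: pt0 => /andP[]; rewrite le_eqVlt => /predU1P[<-{p} _|p0 pt]; last by apply: pos; rewrite p0.
rewrite leNgt; apply/negP => h.
have sl : slab t (x, 0, 0) by split; rewrite /= ?lexx ltW.
pose c := (bdry x + u (x, q, 0, 0)) / 2.
have [c1 c2] : bdry x < c /\ c < u (x, q, 0, 0) by rewrite /c; split; lra.
have c4 : u (x, g w q, pw, 0) < c.
  apply: le_lt_trans c1; apply: pos; move: dp => /andP[dp ->].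
  by rewrite (lt_le_trans delta_gt0).
have [e e0 He] := near_triple (near_lt 0 0 bdry_cont c1).
have [|e2 e20 He2] := near_triple (Mplus_le_near 0 u_busc.2 Ww dp _ c4); first by rewrite lexx ltW.
pose e' := Num.min e e2.
have e'0 : 0 < e' by rewrite lt_min e0.
have /andP[ee1 ee2] : (e' <= e) && (e' <= e2) by rewrite -le_min.
have [y [p' [s' [[_ sl'] [ex ep es] uu]]]] :=
  contact_sub Lf_ge0 f_bnd u_busc u_sub (U_neq0 q) sl (or_introl erefl) e'0.
have /= hb := He y p' s' (le_trans ex ee1) (le_trans ep ee1) (le_trans es ee1); have vy := vb y.
case=> [uv|[pp Mu]|[ss Mu]]; [lra| |lra].
have := He2 y p' s' (le_trans ex ee2) (le_trans ep ee2) (le_trans es ee2) sl'.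
by move=> /(le_trans Mu); rewrite lee_fin/=; lra.
Qed.

End Sub.

End BoundaryConditions.

(** * Lower bound for a functional from the slopes of its running minimum *)

Section RunningMinimum.
Context (R : realType) (T : topologicalType).
Variables (S Kc : set T) (G tau : T -> R) (l t K C : R).
Variable E : set R.
Local Notation lambda := (@lebesgue_measure R).
Hypotheses (t_ge0 : 0 <= t) (K_ge0 : 0 <= K).
Hypotheses (Kc_compact : compact Kc) (Kc_sub : Kc `<=` S).
Hypotheses (G_lsc : lsc_in S G) (tau_cont : continuous tau).
Hypothesis tau_itv : forall z, S z -> 0 <= tau z <= t.
Hypothesis G_lb : forall z, S z -> C <= G z.
Hypothesis G_coercive : forall z, S z -> G z < l -> Kc z /\ 0 < tau z.
Hypothesis G_contact : forall z (h k : R -> R), S z -> G z < l ->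
  (forall r, is_derive r (1 : R) h (k r)) -> continuous k ->
  (\forall r \near tau z, forall z', S z' -> tau z' = r -> G z - h (tau z) <= G z' - h r) ->
  - K <= k (tau z) /\ (E (tau z) -> 0 <= k (tau z)).

(** The cap [l] gives the starting value at time 0 and confines minimizers to [Kc]. *)
Definition running_min (r : R) : R := inf ([set l] `|` [set G z | z in [set z | S z /\ tau z <= r]]).

Local Notation mu := running_min.

Let lbd r : has_inf ([set l] `|` [set G z | z in [set z | S z /\ tau z <= r]]).
Proof.
split; first by exists l; left.
exists (Num.min l C) => x [->|[z [Sz _] <-]]; first by rewrite ge_min lexx.
by rewrite ge_min (G_lb Sz) orbT.
Qed.

Lemma running_min_le_level r : mu r <= l.
Proof. by apply: inf_lbound; [case: (lbd r)|left]. Qed.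

Lemma running_min_le r z : S z -> tau z <= r -> mu r <= G z.
Proof. by move=> Sz tz; apply: inf_lbound; [case: (lbd r)|right; exists z]. Qed.

Lemma running_min_ge r c : c <= l -> (forall z, S z -> tau z <= r -> c <= G z) -> c <= mu r.
Proof.
by move=> cl cG; apply: lb_le_inf; [case: (lbd r)|move=> x [->//|[z [Sz tz] <-]]; exact: cG].
Qed.

Lemma running_min_homo r r' : r <= r' -> mu r' <= mu r.
Proof.
move=> rr; apply: running_min_ge (running_min_le_level _) _ => z Sz tz.
by apply: running_min_le => //; exact: le_trans rr.
Qed.

Lemma running_min0 : mu 0 = l.
Proof.
apply/eqP; rewrite eq_le running_min_le_level; apply: running_min_ge => // z Sz tz.
by rewrite leNgt; apply/negP => /(G_coercive Sz)[_]; rewrite ltNge tz.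
Qed.

(* The penalty [c * tau] makes a minimizer on [r <= tau] exist off the boundary
   [tau = r]. *)
Lemma minimizer_from (c a r : R) (z0 : T) : 0 <= c -> S z0 -> r <= tau z0 ->
  a <= l -> G z0 + c * tau z0 < a + c * r ->
  exists2 z, S z /\ r <= tau z & G z + c * tau z <= G z0 + c * tau z0 /\
    forall z', S z' -> r <= tau z' -> G z + c * tau z <= G z' + c * tau z'.
Proof.
move=> c0 Sz0 rz0 al h.
pose D := Kc `&` tau @^-1` [set x | r <= x].
have cD : compact D.
  apply: (compact_closedI Kc_compact); apply: closed_comp; last exact: closed_ge.
  by move=> z _; exact: tau_cont.
have out z : S z -> r <= tau z -> ~ Kc z -> a + c * r <= G z + c * tau z.
  move=> Sz rz nK; apply: lerD; last exact: ler_wpM2l.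
  by apply: le_trans al _; rewrite leNgt; apply/negP => /(G_coercive Sz)[].
have Dz0 : D z0.
  split=> //; apply: contrapT => nK; have := out _ Sz0 rz0 nK; lra.
have lD : lsc_in D (fun z => G z + c * tau z).
  apply: (@lsc_in_le _ _ S); first by move=> z [/Kc_sub].
  apply: lsc_inD => //; apply: continuous_lsc_in => z.
  by apply: cvgM; [exact: cvg_cst|exact: tau_cont].
have [|z [Kz rz] zmin] := lsc_in_compact_min (C := C + c * r) cD (ex_intro _ _ Dz0) lD.
  by move=> z [/Kc_sub Sz rz]; apply: lerD; [exact: G_lb|exact: ler_wpM2l].
exists z; first by split=> //; exact: Kc_sub.
split; first exact: zmin.
move=> z' Sz' rz'; have [Kz'|nK] := pselect (Kc z'); first exact: zmin.
have := out _ Sz' rz' nK; have := zmin _ Dz0; lra.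
Qed.

Lemma running_min_attained r : mu r < l -> exists2 z, S z /\ tau z <= r & G z = mu r.
Proof.
move=> ml.
pose D := Kc `&` tau @^-1` [set x | x <= r].
have cD : compact D.
  apply: (compact_closedI Kc_compact); apply: closed_comp; last exact: closed_le.
  by move=> z _; exact: tau_cont.
have lm : 0 < l - mu r by rewrite subr_gt0.
have [x + hx] := inf_adherent lm (lbd r); rewrite -/(mu r) in hx.
case=> [xl|[z0 [Sz0 rz0] Gx]]; first by move: hx; rewrite xl; lra.
have Dz0 : D z0 by split=> //; apply: (G_coercive Sz0 _).1; rewrite Gx; lra.
have lD : lsc_in D G by apply: (@lsc_in_le _ _ S) => // z [/Kc_sub].
have [|z [Kz rz] zmin] := lsc_in_compact_min (C := C) cD (ex_intro _ _ Dz0) lD.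
  by move=> z [/Kc_sub Sz _]; exact: G_lb.
have Sz := Kc_sub Kz; exists z => //; apply/eqP; rewrite eq_le running_min_le// andbT.
have hz := zmin _ Dz0; apply: running_min_ge; first by lra.
move=> z' Sz' rz'; have [hl|hl] := ltP (G z') l.
  by apply: zmin; split=> //; exact: (G_coercive Sz' hl).1.
by apply: le_trans hl; lra.
Qed.

(** A steeper drop would give, for some [K' > K], a minimizer of [G + K' * tau] at a time strictly
    after [r1], that is a contact of slope [- K'], below the allowed [- K]. *)
Lemma running_min_lipschitz r1 r2 : r1 <= r2 -> mu r1 - mu r2 <= K * (r2 - r1).
Proof.
move=> r12; rewrite leNgt; apply/negP => h.
have ml : mu r2 < l.
  have := running_min_le_level r1; have : 0 <= K * (r2 - r1) by rewrite mulr_ge0// subr_ge0.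
  by move: h; lra.
have [z0 [Sz0 z0r] Gz0] := running_min_attained ml.
have r1z0 : r1 < tau z0.
  rewrite ltNge; apply/negP => le1; have := running_min_le Sz0 le1.
  have : 0 <= K * (r2 - r1) by rewrite mulr_ge0// subr_ge0.
  by move: h; rewrite Gz0; lra.
have Kz : K * (tau z0 - r1) <= K * (r2 - r1) by apply: ler_wpM2l => //; lra.
have d0 : 0 < tau z0 - r1 by lra.
(* Half of the excess is spent on [K'], which keeps [z0] strictly below [mu r1 + K' * r1], a value
   that points of time [r1] cannot beat. *)
pose gap := mu r1 - mu r2 - K * (r2 - r1); pose K' := K + gap / (2 * (tau z0 - r1)).
have g0 : 0 < gap by rewrite /gap; lra.
have KK' : K < K' by rewrite /K' ltrDl divr_gt0// mulr_gt0.
have K'z : K' * (tau z0 - r1) = K * (tau z0 - r1) + gap / 2.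
  by rewrite /K' mulrDl; congr (_ + _); field; rewrite gt_eqF.
have hG : G z0 + K' * tau z0 < mu r1 + K' * r1.
  by move: K'z; rewrite !mulrBr Gz0 /gap; move: g0; rewrite /gap; lra.
have [z [Sz rz] [zle zmin]] := minimizer_from (ltW (le_lt_trans K_ge0 KK')) Sz0 (ltW r1z0) (running_min_le_level r1) hG.
have rz' : r1 < tau z.
  rewrite lt_neqAle rz andbT; apply/eqP => e; have tz1 : tau z <= r1 by rewrite -e.
  by have := running_min_le Sz tz1; move: zle hG; rewrite -e; lra.
have Gl : G z < l.
  have := ler_wpM2l (ltW (le_lt_trans K_ge0 KK')) rz; have := running_min_le_level r1; lra.
have dh r : is_derive r (1 : R) (fun r => - K' * r) ((cst (- K')) r).
  by apply: is_derive_eq; rewrite /GRing.scale/= mulr1.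
have [||] := G_contact Sz Gl dh; first exact: cst_continuous.
  near=> r => z' Sz' z'r; have := zmin z' Sz'; rewrite z'r.
  have r1r : r1 <= r by apply/ltW; near: r; exact: lt_nbhsr.
  by move=> /(_ r1r); lra.
by rewrite lerN2 /= leNgt KK'.
Unshelve. all: by end_near. Qed.

(** If [mu] decreased at rate [a > 0], a C^1 function [h] would touch [- mu] from above at [s]. Then
    [- h] is a contact function for [G] at a minimizer of time exactly [s], with slope [- a], which
    [E] forbids. *)
Lemma running_min_derive s : E s -> derivable (fun r => - mu r) s 1 ->
  derive1 (fun r => - mu r) s <= 0.
Proof.
move=> Es dF; rewrite leNgt; apply/negP => a0.
have [|h [k [dh ck ks hs hF]]] := @C1_upper_contact R (fun r => - mu r) s K _ dF.
  move=> r; have [r0|r0] := leP 0 r.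
    have := @running_min_lipschitz s (s + r) ltac:(lra); have := @running_min_homo s (s + r) ltac:(lra).
    by move=> ? ?; rewrite !ger0_norm//; lra.
  have := @running_min_lipschitz (s + r) s ltac:(lra); have := @running_min_homo (s + r) s ltac:(lra).
  by move=> ? ?; rewrite ler0_norm ?[`|r|]ltr0_norm//; lra.
rewrite /= in hs hF; set a := derive1 _ s in a0 ks.
have /nbhs_ballP[e /= e0 He] : \forall r \near s, a / 2 < k r /\ - mu r <= h r.
  near=> r; split; last by near: r.
  near: r; apply: (cvgr_gt (k s)); first exact: ck.
  by rewrite ks; lra.
(* The drop comes from the slope of [h] close to [s] and from monotonicity farther away. It forces a
   minimizer realizing [mu s] to have time [s]. *)
have left r : r < s -> mu s < mu r.
  move=> rs; rewrite ltNge; apply/negP => le_r.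
  pose r' := Num.max r (s - e / 2).
  have [rr' r'1] : r <= r' /\ s - e / 2 <= r' by rewrite !le_max !lexx orbT.
  have r's : r' < s by rewrite gt_max rs/=; lra.
  have inc : a / 2 * (s - r') <= h s - h r'.
    apply: (le_of_derive_ge dh (ltW r's)) => z /andP[z1 z2]; have [|/ltW//] := He z.
    by rewrite /ball/= ger0_norm; lra.
  have [|_] := He r'; first by rewrite /ball/= ger0_norm; lra.
  have := running_min_homo rr'; have : 0 < a / 2 * (s - r') by rewrite mulr_gt0; lra.
  by move: inc; rewrite hs; lra.
have ml : mu s < l.
  by have := left (s - 1) ltac:(lra); have := running_min_le_level (s - 1); lra.
have [z [Sz zs] Gz] := running_min_attained ml.
have tz : tau z = s.
  apply/eqP; rewrite eq_le zs leNgt; apply/negP => /left.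
  by rewrite -Gz ltNge running_min_le.
have dN r : is_derive r (1 : R) (fun r => - h r) (- k r) by exact: is_deriveN.
have Gzl : G z < l by rewrite Gz.
have [||_ +] := G_contact Sz Gzl dN.
- by move=> r; apply: cvgN; exact: ck.
- rewrite tz; near=> r => z' Sz' z'r; rewrite Gz hs opprK.
  have : - mu r <= h r by near: r.
  have := @running_min_le r z' Sz' _; rewrite z'r lexx => /(_ isT); lra.
by rewrite tz => /(_ Es); rewrite ks; lra.
Unshelve. all: by end_near. Qed.

(** The total decrease of [mu] from its initial value [l] is at most [K] times the measure of the
    times outside [E]. *)
Lemma contact_lower_bound (c0 : R) :
  measurable (E : set (measurableTypeR R)) ->
  (K%:E * lambda (`]0%R, t]%classic `\` E) <= c0%:E)%E ->
  forall z, S z -> l - c0 <= G z.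
Proof.
move=> mE Ec0 z Sz.
have incr x y : x <= y -> 0 <= - mu y - - mu x <= K * (y - x).
  move=> xy; apply/andP; split; first by have := running_min_homo xy; lra.
  by have := running_min_lipschitz xy; lra.
have := @lipschitz_growth_le R (fun r => - mu r) K t E incr K_ge0 t_ge0 mE running_min_derive.
move=> /le_trans/(_ Ec0); rewrite lee_fin running_min0.
have /andP[_ zt] := tau_itv Sz; have := running_min_le Sz zt; lra.
Qed.

End RunningMinimum.

(** * Doubling of variables at a fixed mode *)

Section Doubling.
Context (R : realType) (d m dq : nat) (delta t : R).
Context (U : mode dq -> set 'rV[R]_m) (W : mode dq -> set (mode dq)).
Context (f : R -> 'rV[R]_d -> 'rV[R]_m -> mode dq -> 'rV[R]_d).
Context (g : mode dq -> mode dq -> mode dq) (phi varphi : 'rV[R]_d -> R).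
Local Notation X := 'rV[R]_d.
Local Notation Y := (X * R * R)%type.
Variable Lf : R.
Hypothesis Lf_gt0 : 0 < Lf.
Hypothesis f_lip : forall s y y' q v, 0 <= s -> U q v ->
  enorm (f s y v q - f s y' v q) <= Lf * enorm (y - y').
Hypothesis f_bnd : forall s y q v, 0 <= s -> U q v -> enorm (f s y v q) <= Lf.
Variables (u1 u2 : state R d dq -> R) (q : mode dq).
Hypothesis u1_sub : subsolution delta t U W f g phi varphi u1.
Hypothesis u2_super : supersolution delta t U W f g phi varphi u2.

(* The factor [expR (2 * Lf * s)] absorbs the error due to the Lipschitz
   dependence of [f] on the space variable. *)
Definition penalty (N M c : R) (z : Y * Y) : R :=
  N * expR (2 * Lf * z.2.2) * dotp (z.1.1.1 - z.2.1.1) (z.1.1.1 - z.2.1.1) +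
  M * ((z.1.2 - z.2.2) ^+ 2 + (z.1.1.2 - z.2.1.2) ^+ 2) + c * dotp z.2.1.1 z.2.1.1.

(** The first point carries [u1], the second [u2]; the signs are such that comparison is a lower
    bound. The terms in [b] sit on the second point, so their net derivative [b] enters the
    supersolution inequality. *)
Definition doubled (N M c b : R) (z : Y * Y) : R :=
  u2 (at_mode q z.2) - u1 (at_mode q z.1) + penalty N M c z + 2 * b * z.2.2 - b * z.2.1.2.

Lemma enormN (x : X) : enorm (- x) = enorm x.
Proof. by rewrite -scaleN1r enormZ normrN1 mul1r. Qed.

Lemma dotp_subC (x y : X) : dotp (x - y) (x - y) = dotp (y - x) (y - x).
Proof. by rewrite -!enorm_sqr -(enormN (x - y)) opprB. Qed.

(** Subtracting the two inequalities cancels the derivatives of the [M] terms, so [M] is absent from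
    the conclusion, and leaves [2 * b - b]. Only the time of [u2] is prescribed in the contact
    hypothesis; that of [u1] stays free. *)
Lemma contact_slope (N M c b : R) (x y : X) (p s p' s' : R) (h k : R -> R) :
  0 <= N -> slab t (x, p, s) -> slab t (y, p', s') ->
  0 < p -> 0 < s -> 0 < p' -> 0 < s' -> varphi x < u1 (x, q, p, s) ->
  (forall r, is_derive r (1 : R) h (k r)) -> continuous k ->
  (\forall r \near s', forall z, slab t z.1 -> slab t z.2 -> z.2.2 = r ->
     doubled N M c b ((x, p, s), (y, p', s')) - h s' <= doubled N M c b z - h r) ->
  forall z e, z = (2 * (N * expR (2 * Lf * s'))) *: (x - y) -> 0 < e ->
  exists2 v, U q v & forall v1, U q v1 ->
    b - e + 2 * c * dotp (f s' y v q) y + (dotp (f s y v1 q) z - dotp (f s' y v q) z) < k s'.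
Proof.
move=> N0 sl1 sl2 p0 s0 p'0 s'0 ux dh ck mn z e zdef e0.
set E := expR (2 * Lf * s'); have E0 : 0 < E by exact: expR_gt0.
have dA0 r : is_derive r (1 : R) (cst (N * E)) (cst 0 r) by exact: is_derive_cst.
have cA0 : continuous (cst 0 : R -> R) by exact: cst_continuous.
have [|/(_ p0 s0 ux) Hsub _ _] := sub_quad (q := q) (a := y) (c := 0) dA0 cA0
    (is_derive_pen M p' 0) (@continuous_pen' _ M p' 0)
    (is_derive_pen M s' 0) (@continuous_pen' _ M s' 0) (sl1 : Obar t (x, q, p, s)) u1_sub.
  apply: (@nearW _ (nbhs (x, p, s))) => w Dw.
  have := nbhs_singleton mn (w, (y, p', s')) Dw sl2 erefl.
  by rewrite /doubled /penalty /quad /pen/= -/E; lra.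
have dA r : is_derive r (1 : R) (fun r => - (N * expR (2 * Lf * r))) (- (2 * Lf * (N * expR (2 * Lf * r)))).
  have d1 : is_derive r (1 : R) (fun r : R => 2 * Lf * r) (2 * Lf).
    by apply: is_derive_eq; rewrite /GRing.scale/= mulr1.
  have d2 := is_derive1_comp (is_derive_expR (2 * Lf * r)) d1.
  by apply: is_derive_eq; rewrite /GRing.scale/=; ring.
have cA : continuous (fun r => - (2 * Lf * (N * expR (2 * Lf * r)))).
  move=> r; apply: cvgN; apply: cvgM; first exact: cvg_cst.
  apply: cvgM; first exact: cvg_cst.
  apply: (@continuous_comp _ _ _ (fun r => 2 * Lf * r) expR); last exact: continuous_expR.
  by apply: cvgM; [exact: cvg_cst|exact: cvg_id].
have dB r : is_derive r (1 : R) (fun r => pen (- M) s (- (2 * b)) r + h r) (2 * (- M) * (r - s) + - (2 * b) + k r).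
  by have := dh r; have := is_derive_pen (- M) s (- (2 * b)) r => d1 d2; exact: is_deriveD.
have cB : continuous (fun r => 2 * (- M) * (r - s) + - (2 * b) + k r).
  by move=> r; apply: cvgD; [exact: continuous_pen'|exact: ck].
have [|/(_ p'0 s'0) [_ Hsup] _ _] := super_quad (q := q) (a := x) (c := - c) dA cA
    (is_derive_pen (- M) p b) (@continuous_pen' _ (- M) p b) dB cB (sl2 : Obar t (y, q, p', s')) u2_super.
  have nT : nbhs y [set: X] by exact: filterT.
  apply: filterS (near_ends p' nT mn) => w /= [_ H] sw.
  have := H ((x, p, s), w) sl1 sw erefl.
  by rewrite /doubled /penalty /quad /pen/= (dotp_subC x y) (dotp_subC x w.1.1); lra.
have [v Uv h3] := Hsup e e0; exists v => // v1 Uv1; rewrite -/E in zdef.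
have := Hsub v1 Uv1; rewrite /cst mul0r !add0r mulr0 scale0r !addr0 -zdef => h1.
(* Replacing [x] by [y] in [f] costs [Lf * |x - y| * |z|] with [|z| = 2 * N * E * |x - y|], exactly
   what the derivative of the exponential weight pays for. *)
have h2 : dotp (f s y v1 q) z - 2 * Lf * (N * E) * dotp (x - y) (x - y) <= dotp (f s x v1 q) z.
  rewrite lerBlDl -lerBlDr -dotpBl; apply: le_trans (ler_norm _) _.
  apply: le_trans (cauchy_schwarz _ _) _; rewrite zdef enormZ ger0_norm; last first.
    by rewrite !mulr_ge0// ltW.
  have := f_lip y x (ltW s0) Uv1; rewrite -(enormN (y - x)) opprB => hl.
  apply: le_trans (ler_wpM2r _ hl) _; first by rewrite !mulr_ge0 ?enorm_ge0// ltW.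
  by rewrite -enorm_sqr le_eqVlt; apply/orP; left; apply/eqP; ring.
have zE : (2 * - (N * E)) *: (y - x) + (2 * - c) *: y = z - (2 * c) *: y.
  by rewrite zdef !mulrN !scaleNr -scalerN opprB.
move: h3; rewrite -/E zE (dotpBr _ z) dotpZr (dotp_subC y x); lra.
Qed.

End Doubling.

Lemma lsc_in_comp (R : realType) (T T' : topologicalType) (D : set T') (S : set T)
    (h : T' -> R) (F : T -> T') :
  lsc_in D h -> continuous F -> (forall z, S z -> D (F z)) -> lsc_in S (fun z => h (F z)).
Proof.
move=> lh cF SD z Sz c hc; have H : \forall z' \near z, D (F z') -> c < h (F z') by exact: (cF z _ (lh _ (SD _ Sz) c hc)).
by apply: filterS H => z' H Sz'; apply: H; exact: SD.
Qed.

(** * Comparison near the diagonal, at the boundary or on the obstacle *)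

Section NearDiagonal.
Context (R : realType) (d dq : nat) (t b B c0 : R).
Local Notation X := 'rV[R]_d.
Local Notation Y := (X * R * R)%type.
Variables (u1 u2 : Y -> R) (varphi : X -> R).
Hypotheses (b_ge0 : 0 <= b) (c0_gt0 : 0 < c0) (bt_le : b * t <= B).
Hypotheses (u1_usc : lsc_in (slab t) (fun y => - u1 y)) (u2_lsc : lsc_in (slab t) u2).
Hypothesis varphi_cont : continuous varphi.
Hypothesis u2_obstacle : forall y : Y, slab t y -> 0 < y.1.2 -> 0 < y.2 -> varphi y.1.1 <= u2 y.
Hypothesis bdry_le : forall y : Y, slab t y -> y.1.2 = 0 \/ y.2 = 0 ->
  u1 y - u2 y - 2 * b * y.2 + b * y.1.2 <= B.

(** On the boundary, semicontinuity transfers [bdry_le] to close pairs. At an interior [w], close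
    points are interior too, and the remaining case [u1 <= varphi] follows from [varphi <= u2],
    continuity of [varphi] and [b * t <= B]. *)
Lemma near_diagonal_point (w : Y) : slab t w ->
  \forall w1 \near w & w2 \near w, slab t w1 -> slab t w2 ->
    [\/ w1.1.2 = 0, w1.2 = 0, w2.1.2 = 0 | w2.2 = 0] \/ u1 w1 <= varphi w1.1.1 ->
    - B - c0 <= u2 w2 - u1 w1 + 2 * b * w2.2 - b * w2.1.2.
Proof.
move=> sw.
have cs : (fun y : Y => y.2) y @[y --> w] --> w.2 by exact: cvg_snd.
have c1 : (fun y : Y => y.1) y @[y --> w] --> w.1 by exact: cvg_fst.
have cp : y.1.2 @[y --> w] --> w.1.2 by apply: (cvg_comp _ _ c1); exact: cvg_snd.
have cx : y.1.1 @[y --> w] --> w.1.1 by apply: (cvg_comp _ _ c1); exact: cvg_fst.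
have [bw|nbw] := pselect (w.1.2 = 0 \/ w.2 = 0).
  have h := bdry_le sw bw; have c4 : 0 < c0 / 4 by rewrite divr_gt0.
  have n1 : \forall w1 \near w, slab t w1 -> - u1 w - c0 / 4 < - u1 w1.
    by apply: u1_usc => //; lra.
  have n2 : \forall w2 \near w, slab t w2 -> u2 w - c0 / 4 < u2 w2.
    by apply: u2_lsc => //; lra.
  have ck : (2 * b * y.2 - b * y.1.2) @[y --> w] --> 2 * b * w.2 - b * w.1.2.
    by apply: cvgB; apply: cvgM; [exact: cvg_cst|exact: cs|exact: cvg_cst|exact: cp].
  have n3 : \forall w2 \near w, 2 * b * w.2 - b * w.1.2 - c0 / 4 < 2 * b * w2.2 - b * w2.1.2.
    by apply: (cvgr_gt _ ck); lra.
  exists ([set w1 | slab t w1 -> - u1 w - c0 / 4 < - u1 w1],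
    [set w2 | (slab t w2 -> u2 w - c0 / 4 < u2 w2) /\ 2 * b * w.2 - b * w.1.2 - c0 / 4 < 2 * b * w2.2 - b * w2.1.2]) => /=.
    by split=> //; exact: filterI.
  by move=> [w1 w2] /= [h1 [h2 h3]] s1 s2 _; have := h1 s1; have := h2 s2; lra.
have [/= /andP[p0 _] /andP[s0 _]] := sw.
have wp : 0 < w.1.2 by rewrite lt_neqAle p0 andbT; apply/eqP => e; apply: nbw; left.
have ws : 0 < w.2 by rewrite lt_neqAle s0 andbT; apply/eqP => e; apply: nbw; right.
have np : \forall y \near w, 0 < y.1.2 by apply: (cvgr_gt _ cp).
have ns : \forall y \near w, 0 < y.2 by apply: (cvgr_gt _ cs).
have cv : varphi y.1.1 @[y --> w] --> varphi w.1.1 by apply: (cvg_comp _ _ cx); exact: varphi_cont.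
have nv : \forall y \near w, `|varphi w.1.1 - varphi y.1.1| <= c0 / 2.
  by move/cvgrPdist_le : cv; apply; rewrite divr_gt0.
pose A := [set y : Y | [/\ 0 < y.1.2, 0 < y.2 & `|varphi w.1.1 - varphi y.1.1| <= c0 / 2]].
have nA : nbhs w A.
  by apply: filterS3 np ns nv => y; split.
exists (A, A) => //= -[w1 w2] /= [[p1 s1 v1] [p2 s2 v2]] sl1 sl2 [|uv].
  by case=> h; move: p1 s1 p2 s2; rewrite h ltxx.
have h1 := u2_obstacle sl2 p2 s2; have pt : w2.1.2 <= t by case: sl2 => /andP[].
have h2 : 0 <= b * w2.2 := mulr_ge0 b_ge0 (ltW s2).
have h3 : b * w2.1.2 <= b * t := ler_wpM2l b_ge0 pt.
move: v1 v2; rewrite !ler_norml => /andP[? ?] /andP[? ?]; have := bt_le; lra.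
Qed.

Lemma near_diagonal (R0 : R) : exists2 eta, 0 < eta &
  forall w1 w2 : Y, slab t w1 -> slab t w2 -> `|w2.1.1| <= R0 ->
    enorm (w1.1.1 - w2.1.1) <= eta -> `|w1.1.2 - w2.1.2| <= eta -> `|w1.2 - w2.2| <= eta ->
    [\/ w1.1.2 = 0, w1.2 = 0, w2.1.2 = 0 | w2.2 = 0] \/ u1 w1 <= varphi w1.1.1 ->
    - B - c0 <= u2 w2 - u1 w1 + 2 * b * w2.2 - b * w2.1.2.
Proof.
have /compact_near_coveringP/near_covering_withinP cov := @compact_slab_ball R d t R0.
pose P (n : nat) (w2 : Y) := forall w1 : Y, slab t w1 ->
    enorm (w1.1.1 - w2.1.1) <= n.+1%:R^-1 -> `|w1.1.2 - w2.1.2| <= n.+1%:R^-1 -> `|w1.2 - w2.2| <= n.+1%:R^-1 ->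
    [\/ w1.1.2 = 0, w1.2 = 0, w2.1.2 = 0 | w2.2 = 0] \/ u1 w1 <= varphi w1.1.1 ->
    - B - c0 <= u2 w2 - u1 w1 + 2 * b * w2.2 - b * w2.1.2.
suff step : forall w, [set y : Y | slab t y /\ `|y.1.1| <= R0] w ->
    \forall w' \near w & n \near \oo, [set y : Y | slab t y /\ `|y.1.1| <= R0] w' -> P n w'.
  have [n _ /(_ n (leqnn _)) H] := cov _ \oo P _ step.
  exists n.+1%:R^-1; first by rewrite invr_gt0.
  by move=> w1 w2 s1 s2 yR e1 e2 e3; apply: (H w2 (conj s2 yR)).
move=> w [sw _]; have [[A1 A2] /= [/nbhs_ballP[r1 /= r10 H1] /nbhs_ballP[r2 /= r20 H2]] HA] := near_diagonal_point sw.
pose r := Num.min r1 r2; have r0 : 0 < r by rewrite lt_min r10.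
have r0' : 0 < r / 2 by rewrite divr_gt0.
exists (ball w (r / 2), [set n | n.+1%:R^-1 < r / 2]) => /=.
  by split; [exact: nbhsx_ballx|exact: (near_infty_natSinv_lt (PosNum r0'))].
move=> [w2 n] /= [bw2 nr] [s2 _] w1 s1 e1 e2 e3 bad.
apply: (HA (w1, w2)) => //=; split; last first.
  by apply: H2; apply: le_ball bw2; rewrite (le_trans (_ : r / 2 <= r)) ?ge_min ?lexx ?orbT//; lra.
apply: H1; apply: (@le_ball _ _ _ r); first by rewrite ge_min lexx.
have -> : r = r / 2 + r / 2 by lra.
apply: ball_triangle bw2 _.
split; [split|].
- rewrite -ball_normE /ball_/= distrC; apply: le_lt_trans nr; apply: le_trans e1.
  by rewrite -ler_sqr ?nnegrE ?enorm_ge0// enorm_sqr norm_sqr_le_dotp.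
- by rewrite /ball/= distrC; apply: le_lt_trans nr.
- by rewrite /ball/= distrC; apply: le_lt_trans nr.
Qed.

End NearDiagonal.

(** The gain [b] is spent by quarters: the supersolution slack, the confinement term in [c], and, in
    the second part, the tolerance of good times. *)
Lemma slope_lower_bounds (R : realFieldType) (b c L n d0 d1 d2 Z k : R) :
  0 < b -> 0 <= c -> `|d0| <= L * n -> 2 * c * L * n <= b / 4 ->
  (`|d1| <= L * Z -> `|d2| <= L * Z -> b - b / 4 + 2 * c * d0 + (d1 - d2) < k -> - (2 * L * Z) <= k) /\
  (d2 <= k - (b - b / 4 + 2 * c * d0) + d2 + b / 4 -> 0 <= k).
Proof.
move=> b0 c0 hd0 hn; have h : - (b / 4) <= 2 * c * d0.
  have c2 : 0 <= 2 * c by rewrite mulr_ge0.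
  have := ler_wpM2l c2 (lerNnormlW hd0); lra.
split; last by lra.
by rewrite !ler_norml => /andP[? ?] /andP[? ?]; lra.
Qed.

(** * Comparison at a fixed mode with given boundary values *)

Section FixedModeComparison.
Context (R : realType) (d m dq : nat) (delta t : R).
Context (U : mode dq -> set 'rV[R]_m) (W : mode dq -> set (mode dq)).
Context (f : R -> 'rV[R]_d -> 'rV[R]_m -> mode dq -> 'rV[R]_d).
Context (g : mode dq -> mode dq -> mode dq) (phi varphi : 'rV[R]_d -> R).
Local Notation X := 'rV[R]_d.
Local Notation Y := (X * R * R)%type.
Variable Lf : R.
Hypothesis Lf_gt0 : 0 < Lf.
Hypothesis f_lip : forall s y y' q v, 0 <= s -> U q v ->
  enorm (f s y v q - f s y' v q) <= Lf * enorm (y - y').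
Hypothesis f_bnd : forall s y q v, 0 <= s -> U q v -> enorm (f s y v q) <= Lf.
Hypothesis f_cont : forall y q v, U q v -> continuous (fun s : R => f (Num.max s 0) y v q).
Hypothesis varphi_cont : continuous varphi.
Hypothesis t_gt0 : 0 < t.
Variables (u1 u2 : state R d dq -> R) (q : mode dq).
Hypotheses (u1_busc : BUSC t u1) (u2_blsc : BLSC t u2).
Hypothesis u1_sub : subsolution delta t U W f g phi varphi u1.
Hypothesis u2_super : supersolution delta t U W f g phi varphi u2.
Hypothesis u2_obstacle : forall y : Y, slab t y -> 0 < y.1.2 -> 0 < y.2 ->
  varphi y.1.1 <= u2 (at_mode q y).

Lemma le_of_sqr_le (a k : R) : 0 <= a -> a ^+ 2 <= k -> a <= k + 1.
Proof. by move=> a0; rewrite expr2; nra. Qed.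

Lemma le_sqr_succ (k : R) : 0 <= k -> k <= (k + 1) ^+ 2.
Proof. by move=> k0; rewrite expr2; nra. Qed.

Lemma penalty_ge0 (N M c : R) (z : Y * Y) : 0 <= N -> 0 <= M -> 0 <= c -> 0 <= penalty Lf N M c z.
Proof.
move=> N0 M0 c0; rewrite /penalty !addr_ge0 ?mulr_ge0 ?dotp_ge0 ?expR_ge0 ?addr_ge0 ?sqr_ge0//.
Qed.

Lemma continuous_penalty (N M c : R) : continuous (penalty Lf N M c : Y * Y -> R).
Proof.
move=> z.
have c2 : (fun z : Y * Y => z.2) z @[z --> z] --> z.2 by exact: cvg_snd.
have c1 : (fun z : Y * Y => z.1) z @[z --> z] --> z.1 by exact: cvg_fst.
have c21 : z.2.1 @[z --> z] --> z.2.1 by apply: (cvg_comp _ _ c2); exact: cvg_fst.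
have c11 : z.1.1 @[z --> z] --> z.1.1 by apply: (cvg_comp _ _ c1); exact: cvg_fst.
have s2 : z.2.2 @[z --> z] --> z.2.2 by apply: (cvg_comp _ _ c2); exact: cvg_snd.
have s1 : z.1.2 @[z --> z] --> z.1.2 by apply: (cvg_comp _ _ c1); exact: cvg_snd.
have p2 : z.2.1.2 @[z --> z] --> z.2.1.2 by apply: (cvg_comp _ _ c21); exact: cvg_snd.
have p1 : z.1.1.2 @[z --> z] --> z.1.1.2 by apply: (cvg_comp _ _ c11); exact: cvg_snd.
have x2 : z.2.1.1 @[z --> z] --> z.2.1.1 by apply: (cvg_comp _ _ c21); exact: cvg_fst.
have x1 : z.1.1.1 @[z --> z] --> z.1.1.1 by apply: (cvg_comp _ _ c11); exact: cvg_fst.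
have dx : (z.1.1.1 - z.2.1.1) @[z --> z] --> z.1.1.1 - z.2.1.1 by apply: cvgB; [exact: x1|exact: x2].
have ds : (z.1.2 - z.2.2) @[z --> z] --> z.1.2 - z.2.2 by apply: cvgB; [exact: s1|exact: s2].
have dp : (z.1.1.2 - z.2.1.2) @[z --> z] --> z.1.1.2 - z.2.1.2 by apply: cvgB; [exact: p1|exact: p2].
have ex : expR (2 * Lf * z.2.2) @[z --> z] --> expR (2 * Lf * z.2.2).
  apply: (cvg_comp (fun z : Y * Y => 2 * Lf * z.2.2) expR); last exact: continuous_expR.
  by apply: cvgM; [exact: cvg_cst|exact: s2].
rewrite /penalty; apply: cvgD; first apply: cvgD.
- apply: cvgM; first by apply: cvgM; [exact: cvg_cst|exact: ex].
  by apply: (@dotp_continuous _ _ _ (fun z : Y * Y => z.1.1.1 - z.2.1.1) (fun z : Y * Y => z.1.1.1 - z.2.1.1)); exact: dx.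
- apply: cvgM; first exact: cvg_cst.
  by apply: cvgD; rewrite expr2; apply: cvgM.
- apply: cvgM; first exact: cvg_cst.
  by apply: (@dotp_continuous _ _ _ (fun z : Y * Y => z.2.1.1) (fun z : Y * Y => z.2.1.1)); exact: x2.
Qed.

Lemma penalty_terms_le (N M c C0 : R) (z : Y * Y) : 0 <= N -> 0 <= M -> 0 <= c ->
  penalty Lf N M c z <= C0 ->
  [/\ N * expR (2 * Lf * z.2.2) * dotp (z.1.1.1 - z.2.1.1) (z.1.1.1 - z.2.1.1) <= C0,
    M * (z.1.2 - z.2.2) ^+ 2 <= C0, M * (z.1.1.2 - z.2.1.2) ^+ 2 <= C0 &
    c * dotp z.2.1.1 z.2.1.1 <= C0].
Proof.
move=> N0 M0 c0; rewrite /penalty.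
have h1 : 0 <= N * expR (2 * Lf * z.2.2) * dotp (z.1.1.1 - z.2.1.1) (z.1.1.1 - z.2.1.1).
  by rewrite !mulr_ge0 ?expR_ge0 ?dotp_ge0.
have h2 : 0 <= M * (z.1.2 - z.2.2) ^+ 2 by rewrite mulr_ge0 ?sqr_ge0.
have h3 : 0 <= M * (z.1.1.2 - z.2.1.2) ^+ 2 by rewrite mulr_ge0 ?sqr_ge0.
have h4 : 0 <= c * dotp z.2.1.1 z.2.1.1 by rewrite mulr_ge0 ?dotp_ge0.
by rewrite mulrDr => h; split; lra.
Qed.

Lemma exists_scale (C e : R) : 0 < e -> exists2 N, 0 < N & C <= N * e ^+ 2.
Proof.
by move=> e0; have [N N0 h] := exists_penalty (C / 2) e0; exists N => //; lra.
Qed.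

Lemma sqr_le_scale (N e a C : R) : 0 < N -> 0 <= e -> C <= N * e ^+ 2 -> N * a ^+ 2 <= C -> `|a| <= e.
Proof.
by move=> N0 e0 h1 h2; apply: (@sqr_le_abs _ N e a (C / 2)) => //; lra.
Qed.

(** The constants are chosen in the order [c], [R0], [eta], [N], [Z], [K], [r], [M]. The measure of
    bad times must be small relative to [K], which sets the scale [r], and [M] must then force the
    two times within [r]; this is consistent because [K] ignores [M]. *)
Lemma fixed_mode_comparison (b B : R) : 0 < b -> b * t <= B ->
  (forall y : Y, slab t y -> y.1.2 = 0 \/ y.2 = 0 ->
    u1 (at_mode q y) - u2 (at_mode q y) - 2 * b * y.2 + b * y.1.2 <= B) ->
  forall y : Y, slab t y -> u1 (at_mode q y) - u2 (at_mode q y) - 2 * b * y.2 + b * y.1.2 <= B.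
Proof.
move=> b0 btB bd y0 sy0; rewrite leNgt; apply/negP => contra.
set V0 := _ + _ in contra.
(* One [c0] is lost in the level [l], one in the confinement at [y0], one in the decrease of the
   running minimum; the last gives the contradiction. *)
pose c0 := (V0 - B) / 4; have c0_gt0 : 0 < c0 by rewrite /c0; lra.
have V0E : V0 = B + 4 * c0 by rewrite /c0; lra.
have [[C1 hC1] usc1] := u1_busc; have [[C2 hC2] lsc2] := u2_blsc.
have hu1 (y : Y) : slab t y -> u1 (at_mode q y) <= C1.
  by move=> sy; apply: le_trans (ler_norm _) (hC1 (at_mode q y) sy).
have hu2 (y : Y) : slab t y -> - C2 <= u2 (at_mode q y).
  by move=> sy; have := hC2 (at_mode q y) sy; rewrite ler_norml => /andP[].
have l1 : lsc_in (slab t) (fun y : Y => - u1 (at_mode q y)) by exact: lsc_at_mode usc1.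
have l2 : lsc_in (slab t) (fun y : Y => u2 (at_mode q y)) by exact: lsc_at_mode lsc2.
pose l := - B - c0.
(* This bounds the penalty wherever the doubled functional is below [l]. *)
pose C0 := `|l| + `|C1| + `|C2| + b * t + 1.
have bt0 : 0 <= b * t by rewrite mulr_ge0 ?ltW.
have C00 : 0 < C0 by rewrite /C0; have := normr_ge0 l; have := normr_ge0 C1; have := normr_ge0 C2; lra.
pose D0 := dotp y0.1.1 y0.1.1 + 1.
have D00 : 0 < D0 by rewrite /D0 ltr_wpDl// dotp_ge0.
(* The first bound keeps the confinement at [y0] below [c0]. The second gives [(2 * c * Lf * |y|) ^+
   2 <= 4 * c * Lf ^+ 2 * C0 <= b ^+ 2 / 16] on the sublevel, whence 64. *)
pose c := Num.min (c0 / D0) (b ^+ 2 / (64 * Lf ^+ 2 * C0)).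
have Lf2 : 0 < 64 * Lf ^+ 2 * C0.
  by apply: mulr_gt0 => //; apply: mulr_gt0; [exact: ltr0n|exact: exprn_gt0].
have c_gt0 : 0 < c.
  by rewrite lt_min; apply/andP; split; apply: divr_gt0 => //; exact: exprn_gt0.
have cD : c * dotp y0.1.1 y0.1.1 <= c0.
  apply: (@le_trans _ _ (c0 / D0 * D0)); last by rewrite divfK ?gt_eqF.
  apply: ler_pM; [exact: ltW|exact: dotp_ge0|by rewrite ge_min lexx|].
  by rewrite /D0 lerDl.
have cL : c * (64 * Lf ^+ 2 * C0) <= b ^+ 2.
  by rewrite -ler_pdivlMr// ge_min lexx orbT.
pose R0 := C0 / c + 1.
have R0_gt0 : 0 < R0 by rewrite ltr_wpDl// divr_ge0 ?ltW.
have [eta eta0 diag] := near_diagonal (ltW b0) c0_gt0 btB l1 l2 varphi_cont u2_obstacle bd R0.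
have [N N0 hN] := exists_scale C0 eta0.
pose Et := expR (2 * Lf * t); have Et0 : 0 < Et by exact: expR_gt0.
(* The squared norm of the common gradient is at most [4 * N * Et * C0], and [k <= (k + 1) ^+ 2]
   avoids a square root. *)
pose Z := 4 * N * Et * C0 + 1.
have Z0 : 0 < Z by rewrite ltr_wpDl// !mulr_ge0 ?ltW.
pose K := 2 * Lf * Z; have K0 : 0 < K by rewrite !mulr_gt0.
have [r [r0 mE hE]] := good_times (fun s y y' v => @f_lip s y y' q v) (fun s y v => @f_bnd s y q v)
  (fun y v => @f_cont y q v) R0 Z (divr_gt0 b0 (ltr0n _ 4)) (divr_gt0 c0_gt0 K0) (ltW t_gt0).
pose rho := Num.min eta (r / 2).
have rho0 : 0 < rho by rewrite lt_min eta0 divr_gt0.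
have [rho1 rho2] : rho <= eta /\ rho <= r / 2 by rewrite !ge_min !lexx orbT.
have [M M0 hM] := exists_scale C0 rho0.
pose G := doubled Lf u1 u2 q N M c b.
pose S : set (Y * Y) := [set z | slab t z.1 /\ slab t z.2].
pose Kc : set (Y * Y) := [set y | slab t y /\ `|y.1.1| <= R0 + eta] `*` [set y | slab t y /\ `|y.1.1| <= R0].
have sublevel z : S z -> G z < l ->
  [/\ [/\ 0 < z.1.1.2, 0 < z.1.2, 0 < z.2.1.2 & 0 < z.2.2],
      varphi z.1.1.1 < u1 (at_mode q z.1),
      [/\ `|z.1.1.1| <= R0 + eta, `|z.2.1.1| <= R0 & `|z.1.2 - z.2.2| < r],
      2 * c * Lf * enorm z.2.1.1 <= b / 4 &
      enorm ((2 * (N * expR (2 * Lf * z.2.2))) *: (z.1.1.1 - z.2.1.1)) <= Z].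
  move=> [s1 s2]; rewrite /G /doubled => Gl.
  have u1b := hu1 _ s1; have u2b := hu2 _ s2.
  have pt : z.2.1.2 <= t by case: s2 => /andP[].
  have st : 0 <= z.2.2 <= t by case: s2.
  have b1 : b * z.2.1.2 <= b * t by rewrite ler_wpM2l// ltW.
  have b2 : 0 <= b * z.2.2 by rewrite mulr_ge0 ?(ltW b0)//; case/andP: st.
  have pC : penalty Lf N M c z <= C0.
    move: (ler_norm l) (ler_norm C1) (ler_norm C2) Gl u1b u2b b1 b2; rewrite /C0; lra.
  have [t1 t2 t3 t4] := penalty_terms_le (ltW N0) (ltW M0) (ltW c_gt0) pC.
  have e1 : 1 <= expR (2 * Lf * z.2.2).
    rewrite -[X in X <= _]expR0 ler_expR; case/andP: st => st _.
    by apply: mulr_ge0 => //; apply: mulr_ge0 => //; exact: ltW.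
  have et : expR (2 * Lf * z.2.2) <= Et.
    rewrite ler_expR; case/andP: st => _ st; apply: ler_wpM2l => //.
    by apply: mulr_ge0 => //; exact: ltW.
  set E := expR (2 * Lf * z.2.2) in t1 e1 et *.
  set D := dotp (z.1.1.1 - z.2.1.1) _ in t1.
  have D0' : 0 <= D by exact: dotp_ge0.
  have E0 : 0 <= E := le_trans ler01 e1.
  have xx : enorm (z.1.1.1 - z.2.1.1) <= eta.
    rewrite -[enorm _]ger0_norm ?enorm_ge0//; apply: (sqr_le_scale N0 (ltW eta0) hN).
    rewrite enorm_sqr -/D; apply: le_trans t1; rewrite -mulrA; apply: ler_wpM2l; first exact: ltW.
    by rewrite ler_peMl.
  have ss := sqr_le_scale M0 (ltW rho0) hM t2; have pp := sqr_le_scale M0 (ltW rho0) hM t3.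
  have yR : `|z.2.1.1| <= R0.
    have h : `|z.2.1.1| ^+ 2 <= C0 / c.
      by rewrite ler_pdivlMr// mulrC; apply: le_trans t4; rewrite ler_wpM2l ?norm_sqr_le_dotp// ltW.
    move: (normr_ge0 z.2.1.1) h; rewrite /R0; set a := `|_|; set k := C0 / c; exact: le_of_sqr_le.
  have notbad : ~ ([\/ z.1.1.2 = 0, z.1.2 = 0, z.2.1.2 = 0 | z.2.2 = 0] \/ u1 (at_mode q z.1) <= varphi z.1.1.1).
    move=> bad; have := diag z.1 z.2 s1 s2 yR xx (le_trans pp rho1) (le_trans ss rho1) bad.
    have := penalty_ge0 z (ltW N0) (ltW M0) (ltW c_gt0).
    move: Gl; rewrite /l; lra.
  have gt0 a : 0 <= a -> a <> 0 -> 0 < a.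
    by move=> a0 na; rewrite lt_neqAle a0 andbT eq_sym; apply/eqP.
  have [[/andP[p10 _] /andP[s10 _]] [/andP[p20 _] /andP[s20 _]]] := (s1, s2).
  split.
  - by split; apply: gt0 => // h; apply: notbad; left; [constructor 1|constructor 2|constructor 3|constructor 4].
  - by rewrite ltNge; apply/negP => h; apply: notbad; right.
  - split=> //; last by apply: le_lt_trans (le_trans ss rho2) _; rewrite ltr_pdivrMr// ltr_pMr// ltr1n.
    apply: (@le_trans _ _ (`|z.2.1.1| + `|z.1.1.1 - z.2.1.1|)).
      by rewrite -[X in `|X| <= _](subrK z.2.1.1) addrC; exact: ler_normD.
    apply: lerD => //; apply: le_trans xx.
    by rewrite -ler_sqr ?nnegrE ?enorm_ge0// enorm_sqr norm_sqr_le_dotp.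
  - have b4 : 0 <= b / 4 by apply: divr_ge0 => //; exact: ltW.
    rewrite -ler_sqr ?nnegrE//; last by rewrite !mulr_ge0 ?enorm_ge0 ?ltW.
    rewrite !exprMn enorm_sqr.
    have cL2 : 0 <= c * Lf ^+ 2 by apply: mulr_ge0; [exact: ltW|exact: sqr_ge0].
    move: (ler_wpM2l cL2 t4) cL; lra.
  - rewrite -ler_sqr ?nnegrE ?enorm_ge0 ?(ltW Z0)// enorm_sqr dotpZl dotpZr -/D.
    have h1 : N * E * (N * E * D) <= N * Et * C0.
      have NE0 : 0 <= N * E by apply: mulr_ge0 => //; exact: ltW.
      apply: ler_pM => //; first exact: mulr_ge0.
      by apply: ler_wpM2l => //; exact: ltW.
    have h2 : 4 * (N * Et * C0) <= Z ^+ 2.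
      have k0 : 0 <= 4 * N * Et * C0 by rewrite !mulr_ge0 ?ltW.
      rewrite /Z; apply: le_trans (le_sqr_succ k0); rewrite le_eqVlt; apply/orP; left; apply/eqP; ring.
    apply: le_trans h2; apply: le_trans (ler_wpM2l (ler0n _ 4) h1).
    by rewrite le_eqVlt; apply/orP; left; apply/eqP; ring.
have cKc : compact Kc by apply: compact_setX; exact: compact_slab_ball.
have KcS : Kc `<=` S by move=> z [[? _] [? _]].
have cfst : continuous (fun z : Y * Y => z.1) by move=> z; exact: cvg_fst.
have csnd : continuous (fun z : Y * Y => z.2) by move=> z; exact: cvg_snd.
have ctau : continuous (fun z : Y * Y => z.2.2).
  by move=> z; apply: (cvg_comp _ _ (csnd z)); exact: cvg_snd.
have lG : lsc_in S G.
  have lP : lsc_in S (fun z : Y * Y => penalty Lf N M c z + (2 * b * z.2.2 - b * z.2.1.2)).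
    apply: continuous_lsc_in => z; apply: cvgD; first exact: continuous_penalty.
    apply: cvgB; apply: cvgM; [exact: cvg_cst|exact: ctau|exact: cvg_cst|].
    have c21 : z.2.1 @[z --> z] --> z.2.1 by apply: (cvg_comp _ _ (csnd z)); exact: cvg_fst.
    by apply: (cvg_comp _ _ c21); exact: cvg_snd.
  have L2 : lsc_in S (fun z : Y * Y => u2 (at_mode q z.2)).
    by apply: (lsc_in_comp l2 csnd) => z [].
  have L1 : lsc_in S (fun z : Y * Y => - u1 (at_mode q z.1)).
    by apply: (lsc_in_comp l1 cfst) => z [].
  have := lsc_inD (lsc_inD L2 L1) lP.
  by congr lsc_in; apply/funext => z; rewrite /G /doubled !addrA.
have itv z : S z -> 0 <= z.2.2 <= t by case=> _ [].
have Glb z : S z -> - C2 - C1 - b * t <= G z.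
  move=> Sz; have [s1 s2] := Sz; have h1 := hu1 _ s1; have h2 := hu2 _ s2.
  have [/andP[_ pt] /andP[st _]] := s2.
  have h3 := penalty_ge0 z (ltW N0) (ltW M0) (ltW c_gt0).
  have h4 : b * z.2.1.2 <= b * t by apply: ler_wpM2l => //; exact: ltW.
  have h5 : 0 <= 2 * b * z.2.2 by apply: mulr_ge0 => //; apply: mulr_ge0 => //; exact: ltW.
  rewrite /G /doubled; apply: lerB => //; rewrite -[leLHS]addr0; apply: lerD => //.
  by rewrite -[leLHS]addr0; apply: lerD => //; apply: lerB.
have coer z : S z -> G z < l -> Kc z /\ 0 < z.2.2.
  move=> Sz Gl; have [[_ _ _ s0] _ [x1 x2 _] _ _] := sublevel z Sz Gl.
  by case: Sz => ? ?; split.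
have cont z (h k : R -> R) : S z -> G z < l -> (forall r, is_derive r (1 : R) h (k r)) -> continuous k ->
    (\forall r \near z.2.2, forall z', S z' -> z'.2.2 = r -> G z - h z.2.2 <= G z' - h r) ->
    - K <= k z.2.2 /\ (good_time (U q) (fun s y v => f s y v q) R0 Z (b / 4) r z.2.2 -> 0 <= k z.2.2).
  case: z => [[[x p] s] [[y p'] s']] Sz Gl dh ck mn.
  have [[p0 s0 p'0 s'0] uv [_ yR ss] yb zZ] := sublevel _ Sz Gl.
  have [sl1 sl2] := Sz.
  have mn' : \forall r \near s', forall z, slab t z.1 -> slab t z.2 -> z.2.2 = r ->
     doubled Lf u1 u2 q N M c b ((x, p, s), (y, p', s')) - h s' <= doubled Lf u1 u2 q N M c b z - h r.
    by apply: filterS mn => r1 H z sz1 sz2; apply: H.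
  have b4 : 0 < b / 4 by apply: divr_gt0.
  have [v Uv slope] := contact_slope f_lip u1_sub u2_super (ltW N0) sl1 sl2 p0 s0 p'0 s'0 uv dh ck mn' erefl b4.
  rewrite /= in s0 s'0 yR ss yb zZ *; set z := (2 * _) *: (x - y) in slope zZ.
  have fle s1 v1 (w : X) : 0 <= s1 -> U q v1 -> `|dotp (f s1 y v1 q) w| <= Lf * enorm w.
    move=> s10 Uv1; apply: le_trans (cauchy_schwarz _ _) _.
    by apply: ler_wpM2r; [exact: enorm_ge0|exact: f_bnd].
  have fz s1 : 0 <= s1 -> `|dotp (f s1 y v q) z| <= Lf * Z.
    by move=> s10; apply: le_trans (fle _ _ _ s10 Uv) _; rewrite ler_pM2l.
  have [crude fine] := slope_lower_bounds (dotp (f s y v q) z) (dotp (f s' y v q) z) Z (k s')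
    b0 (ltW c_gt0) (fle _ _ y (ltW s'0) Uv) yb.
  split; first by apply: crude; [exact: fz (ltW s0)|exact: fz (ltW s'0)|exact: slope].
  move=> good; apply: fine.
  have zZ' : `|z| <= Z.
    apply: le_trans zZ; rewrite -ler_sqr ?nnegrE ?enorm_ge0// enorm_sqr.
    exact: norm_sqr_le_dotp.
  (* By [slope], the chosen value bounds the Hamiltonian at the time [s] of [u1]; goodness of [s']
     carries the bound to the control [v] selected at [s']. *)
  have := good s (ltW s0) ss y z yR zZ' v (k s' - (b - b / 4 + 2 * c * dotp (f s' y v q) y) + dotp (f s' y v q) z) Uv.
  rewrite (max_idPl (ltW s'0)); apply => v1 Uv1.
  by have := slope v1 Uv1; rewrite -lerBlDr lerBrDl addrA => /ltW.
have E1 : (K%:E * lebesgue_measure (`]0%R, t]%classic `\` [set s | good_time (U q) (fun s y v => f s y v q) R0 Z (b / 4) r s]) <= c0%:E)%E.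
  apply: (le_trans (lee_wpmul2l (_ : (0 <= K%:E)%E) hE)); first by rewrite lee_fin ltW.
  by rewrite -EFinM lee_fin mulrC divfK// gt_eqF.
have := contact_lower_bound (ltW t_gt0) (ltW K0) cKc KcS lG ctau itv Glb coer cont mE E1 (conj sy0 sy0 : S (y0, y0)).
have pen0 : penalty Lf N M c (y0, y0) = c * dotp y0.1.1 y0.1.1.
  rewrite /penalty/= !subrr expr0n/= [dotp 0 0]big1 => [|i _]; last by rewrite mxE mul0r.
  by ring.
by rewrite /G /doubled pen0 /= /l; move: V0E cD c0_gt0; rewrite /V0; lra.
Qed.

End FixedModeComparison.

Lemma hypH2_continuous (R : realType) (d m dq : nat) (U : mode dq -> set 'rV[R]_m)
    (f : R -> 'rV[R]_d -> 'rV[R]_m -> mode dq -> 'rV[R]_d) :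
  hypH2 U f -> forall y q v, U q v -> continuous (fun s : R => f (Num.max s 0) y v q).
Proof.
move=> [H _] y q v Uv s0.
have /subspace_continuousP cf := H q.
have m0 : 0 <= Num.max s0 0 by rewrite le_max lexx orbT.
have cm : (fun s : R => Num.max s 0) s @[s --> s0] --> Num.max s0 0.
  by apply: (@continuous_max R R id (cst 0)); [exact: cvg_id|exact: cvg_cst].
move=> B nB.
have [[P Q] /= [[[P1 P2] /= [n1 n2] s12] nQ] sub] := cf (Num.max s0 0, y, v) (conj m0 Uv) B nB.
have H' : \forall s \near s0, P1 (Num.max s 0) by exact: (cm _ n1).
apply: filterS H' => s Ps; apply: (sub ((Num.max s 0, y), v)).
  by split=> /=; [apply: (s12 (Num.max s 0, y)); split=> //=; exact: nbhs_singleton|exact: nbhs_singleton].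
by split=> //=; rewrite le_max lexx orbT.
Qed.

Lemma continuous_truncate (R : realType) (X : normedModType R) (LK : R) (h : X -> R) :
  lipschitz h -> continuous (truncate LK h).
Proof.
move=> lh; have ch : continuous h.
  have [M0 [_ HM]] := lh; pose M := `|M0| + 1.
  have M0M : M0 < M by rewrite /M; have := ler_norm M0; lra.
  have Mp : 0 < M by rewrite /M ltr_wpDl.
  have hl x y : `|h x - h y| <= M * `|x - y| by exact: (HM M M0M (x, y)).
  move=> x; apply/cvgrPdist_le => e e0; near=> y.
  apply: le_trans (hl x y) _; rewrite mulrC -ler_pdivlMr//.
  by near: y; apply: cvgr_dist_le; [exact: cvg_id|exact: divr_gt0].
move=> x; apply: (@continuous_max R X (fun x => Num.min (h x) LK) (cst (- LK))); last exact: cvg_cst.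
by apply: (@continuous_min R X h (cst LK)); [exact: ch|exact: cvg_cst].
Unshelve. all: by end_near. Qed.

Theorem theorem3p7 (R : realType) (d m dq : nat) (delta t : R)
  (hdelta : 0 < delta) (ht : 0 < t)
  (U : mode dq -> set 'rV[R]_m) (W : mode dq -> set (mode dq))
  (f : R -> 'rV[R]_d -> 'rV[R]_m -> mode dq -> 'rV[R]_d)
  (g : mode dq -> mode dq -> mode dq)
  (H1 : hypH1 U f) (H2 : hypH2 U f) (H3 : hypH3 t U f)
  (H4 : hypH4 R W g) (H5 : hypH5 W g)
  (K X0 : set 'rV[R]_d) (hK : compact K)
  (phit varphit : 'rV[R]_d -> R)
  (phit_lip : lipschitz phit) (varphit_lip : lipschitz varphit)
  (phitP : forall x, phit x <= 0 <-> X0 x)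
  (varphitP : forall x, varphit x <= 0 <-> K x)
  (LK : R) (hLK : 0 < LK)
  (u1 u2 : state R d dq -> R)
  (u1_busc : BUSC t u1) (u2_blsc : BLSC t u2)
  (u1_sub : subsolution delta t U W f g
              (truncate LK phit) (truncate LK varphit) u1)
  (u2_super : supersolution delta t U W f g
                (truncate LK phit) (truncate LK varphit) u2) :
  forall z : state R d dq, Obar t z -> u1 z <= u2 z.
Proof.
have [Lf Lf_gt0 hf] := H1.
have f_lip s y y' q v : 0 <= s -> U q v -> enorm (f s y v q - f s y' v q) <= Lf * enorm (y - y').
  by move=> s0 Uv; case: (hf s y y' q v s0 Uv).
have f_bnd s y q v : 0 <= s -> U q v -> enorm (f s y v q) <= Lf.
  by move=> s0 Uv; case: (hf s y y q v s0 Uv).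
have f_cont := hypH2_continuous H2.
have phi_cont := continuous_truncate (LK := LK) phit_lip.
have varphi_cont := continuous_truncate (LK := LK) varphit_lip.
have tt : 0 < t <= t by rewrite ht lexx.
have Lf0 := ltW Lf_gt0.
have U_neq0 q : exists v, U q v.
  by have [] := super_interior Lf0 f_bnd varphi_cont u2_blsc u2_super q 0 tt tt.
have obstacle q (y : 'rV[R]_d * R * R) : slab t y -> 0 < y.1.2 -> 0 < y.2 ->
    truncate LK varphit y.1.1 <= u2 (at_mode q y).
  move=> [/andP[_ pt] /andP[_ st]] p0 s0.
  have ps : 0 < y.1.2 <= t by rewrite p0.
  have ss : 0 < y.2 <= t by rewrite s0.
  by have [] := super_interior Lf0 f_bnd varphi_cont u2_blsc u2_super q y.1.1 ps ss.
(* Since [2 * b * s <= 2 * b * t], a bound [b * t] on the perturbed difference gives the factor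
   3. *)
have small (b : R) : 0 < b -> forall z, Obar t z -> u1 z - u2 z <= 3 * (b * t).
  move=> b0.
  pose V (z : state R d dq) := u1 z - u2 z - 2 * b * z.2 + b * z.1.2.
  have bt0 : 0 < b * t by rewrite mulr_gt0.
  have [[C1 hC1] _] := u1_busc; have [[C2 hC2] _] := u2_blsc.
  have Vb z : Obar t z -> V z <= C1 + C2 + b * t.
    move=> Dz; have := hC1 z Dz; have := hC2 z Dz; rewrite !ler_norml => /andP[h1 _] /andP[_ h2].
    have [/andP[_ pt] /andP[s0 _]] := Dz.
    have h3 : b * z.1.2 <= b * t by apply: ler_wpM2l => //; exact: ltW.
    have h4 : 0 <= b * z.2 by apply: mulr_ge0 => //; exact: ltW.
    by rewrite /V; lra.
  pose z0 : state R d dq := (0, ord0 : mode dq, t, t).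
  have D0 : Obar t z0 by split; rewrite /= lexx ltW.
  have hs : has_sup [set V z | z in Obar t].
    split; first by exists (V z0), z0.
    by exists (C1 + C2 + b * t) => _ [z Dz <-]; exact: Vb.
  set sigma := sup [set V z | z in Obar t] in hs.
  have Vs z : Obar t z -> V z <= sigma by move=> Dz; apply: ub_le_sup; [case: hs|exists z].
  (* The term [b * t] covers the initial time and the obstacle; [sigma - b * delta] covers the
     switch, after which [p] is at least [delta]. *)
  pose B := Num.max (b * t) (sigma - b * delta).
  have [B1 B2] : b * t <= B /\ sigma - b * delta <= B by rewrite !le_max !lexx orbT.
  have VB z : Obar t z -> V z <= B.
    case: z => [[[x q] p] s] Dz.
    apply: (fixed_mode_comparison Lf_gt0 f_lip f_bnd f_cont varphi_cont ht u1_busc u2_blsc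
      u1_sub u2_super (obstacle q) b0 B1 _ (y := (x, p, s)) Dz).
    move=> {x p s Dz} [[x p] s] [/= /andP[p0 pt] /andP[s0 st]] bd.
    have [s00|s_neq0] := eqVneq s 0.
      rewrite s00 /at_mode/=.
      have pp : 0 <= p <= t by rewrite p0.
      (* Only the existence of an admissible switch is retained, so the time [t] and the tolerance 1
         are arbitrary. *)
      have [w [p' [Ww dp _]]] := super_switch hdelta Lf0 f_bnd ht u2_blsc u2_super q x tt ltr01.
      have h1 := sub_initial hdelta Lf0 f_bnd ht phi_cont varphi_cont u1_busc u1_sub U_neq0 x pp
        (ex_intro _ w (ex_intro _ p' (conj Ww dp))).
      have h2 := super_initial hdelta Lf0 f_bnd ht phi_cont varphi_cont u2_blsc u2_super q x pp.
      have h3 : b * p <= b * t by apply: ler_wpM2l => //; exact: ltW.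
      lra.
    have p00 : p = 0 by case: bd => // h; move: s_neq0; rewrite h eqxx.
    have s_gt0 : 0 < s by rewrite lt_neqAle eq_sym s_neq0.
    have ss : 0 < s <= t by rewrite s_gt0.
    rewrite p00 /at_mode/=; apply/ler_addgt0Pr => c c0.
    (* One switch serves both functions: it is almost optimal for [u2], and the bound on [u1] holds
       for every admissible switch. *)
    have [w [p' [Ww dp h2]]] := super_switch hdelta Lf0 f_bnd ht u2_blsc u2_super q x ss c0.
    have p'0 : 0 < p' <= t by move: dp => /andP[h ->]; rewrite (lt_le_trans hdelta).
    have := sub_switch hdelta Lf0 f_bnd ht varphi_cont u1_busc u1_sub U_neq0 x ss Ww dp.
    have bs : 0 < b * s by rewrite mulr_gt0.
    rewrite le_max => /orP[h1|h1].
      have [h3 _] := super_interior Lf0 f_bnd varphi_cont u2_blsc u2_super (g w q) x p'0 ss.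
      lra.
    have Dz : Obar t (x, g w q, p', s).
      by split=> /=; [case/andP: p'0 => /ltW -> ->|rewrite s0].
    have := Vs _ Dz; rewrite /V/= => h3.
    have h4 : b * delta <= b * p' by apply: ler_wpM2l; [exact: ltW|case/andP: dp].
    lra.
  have sB : sigma <= B by apply: ge_sup; [case: hs|move=> _ [z Dz <-]; exact: VB].
  (* The alternative [sigma <= sigma - b * delta] is absurd. *)
  have sbt : sigma <= b * t.
    move: sB; rewrite le_max => /orP[//|]; have : 0 < b * delta by rewrite mulr_gt0.
    lra.
  move=> z Dz; have := Vs z Dz; rewrite /V.
  have [/andP[p0 _] /andP[_ st]] := Dz.
  have h3 : 0 <= b * z.1.2 by apply: mulr_ge0 => //; exact: ltW.
  have h4 : b * z.2 <= b * t by apply: ler_wpM2l => //; exact: ltW.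
  lra.
move=> z Dz; rewrite -subr_le0; apply/ler_addgt0Pr => e e0; rewrite add0r.
have b0 : 0 < e / (3 * t) by rewrite divr_gt0// mulr_gt0.
have := small _ b0 z Dz.
have -> : 3 * (e / (3 * t) * t) = e by field; rewrite gt_eqF.
by [].
Qed.
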